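(* Let $k\ge 1$ be an integer, $\lambda_1,\lambda_2>0$ and $0<\alpha\le 1$. Let $\{\mathcal{S}^{k}_{\alpha}(t)\}_{t\ge0}$ be the fractional Skellam process of order $k$ with parameters $\lambda_1,\lambda_2,\alpha$. Then its state probabilities $p^{k}_{\alpha}(n,t)=\mathrm{Pr}\{\mathcal{S}^{k}_{\alpha}(t)=n\}$, $n\in\mathbb{Z}$, solve the following system of fractional differential equations: $$\partial_{t}^{\alpha}p^{k}_{\alpha}(n,t)=-k(\lambda_{1}+\lambda_{2})p^{k}_{\alpha}(n,t)+\lambda_{1}\sum_{j=1}^{k}p^{k}_{\alpha}(n-j,t)+\lambda_{2}\sum_{j=1}^{k}p^{k}_{\alpha}(n+j,t),$$ with the initial conditions $p^{k}_{\alpha}(0,0)=1$ and $p^{k}_{\alpha}(n,0)=0$ for $n\neq0$. Here $\partial_t^\alpha$ is the Caputo fractional derivative.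
   Context: Poisson process of order $k$ (PPoK) with intensity $\lambda>0$: $N^k(t)=\sum_{i=1}^{N(t)}X_i$, where $\{N(t)\}_{t\ge0}$ is a Poisson process with intensity $k\lambda$, and $\{X_i\}_{i\ge1}$ are iid, uniform on $\{1,2,\dots,k\}$, and independent of $\{N(t)\}_{t\ge0}$. Skellam process of order $k$ (SPoK): $S^k(t)=N_1^k(t)-N_2^k(t)$, where $\{N_1^k(t)\}_{t\ge0}$ and $\{N_2^k(t)\}_{t\ge0}$ are independent PPoK with intensities $\lambda_1>0$ and $\lambda_2>0$, respectively. Inverse stable subordinator: for $0<\alpha<1$, the stable subordinator $\{D_\alpha(t)\}_{t\ge0}$ is the subordinator with $\mathbb{E}(e^{-sD_\alpha(t)})=e^{-ts^\alpha}$, $s>0$, and $Y_\alpha(t)=\inf\{r\ge0: D_\alpha(r)>t\}$, $t\ge 0$. Fractional Skellam process of order $k$ (FSPoK): $\mathcal{S}^k_\alpha(t)=S^k(Y_\alpha(t))$ for $0<\alpha<1$, where $\{Y_\alpha(t)\}_{t\ge0}$ is independent of $\{S^k(t)\}_{t\ge0}$, and $\mathcal{S}^k_1(t)=S^k(t)$ for $\alpha=1$. Caputo fractional derivative: $\partial_t^\alpha f(t)=\frac{1}{\Gamma(1-\alpha)}\int_0^t (t-s)^{-\alpha}f'(s)\,\mathrm{d}s$ for $0<\alpha<1$, and $\partial_t^1 f(t)=f'(t)$. *)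

(* Defs.v *)
From HB Require Import structures.
From mathcomp Require Import all_boot all_order all_algebra.
From mathcomp Require Import finmap.
From mathcomp Require Import all_classical all_reals all_analysis.

Set Implicit Arguments.
Unset Strict Implicit.
Unset Printing Implicit Defensive.

Import Order.TTheory GRing.Theory Num.Theory.
Import numFieldNormedType.Exports.

Local Open Scope classical_set_scope.
Local Open Scope ring_scope.

(* int carries the discrete sigma-algebra, as nat and bool do. *)
HB.instance Definition _ := isPointed.Build int 0.
HB.instance Definition _ := @isMeasurable.Build default_measure_display
  int (@discrete_measurable int) (@discrete_measurable0 int)
  (@discrete_measurableC int) (@discrete_measurableU int).

Section independence.
Context d (T : measurableType d) (R : realType) (P : probability T R).

Definition sigma_family (I : Type) (D : set I) d' (T' : measurableType d')
    (X : I -> T -> T') : set (set T) :=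
  <<s \bigcup_(i in D) preimage_set_system setT (X i) (@measurable _ T') >>.

Definition independent_families
    (I1 : Type) (D1 : set I1) d1 (T1 : measurableType d1) (X1 : I1 -> T -> T1)
    (I2 : Type) (D2 : set I2) d2 (T2 : measurableType d2) (X2 : I2 -> T -> T2) :=
  forall A B, sigma_family D1 X1 A -> sigma_family D2 X2 B ->
    P (A `&` B) = (P A * P B)%E.

Definition mutually_independent (I : choiceType) (D : set I)
    d' (T' : measurableType d') (X : I -> T -> T') :=
  forall (J : {fset I}) (B : I -> set T'),
    [set` J] `<=` D -> (forall i, measurable (B i)) ->
    P (\bigcap_(i in [set` J]) X i @^-1` B i) =
      (\prod_(i <- J) P (X i @^-1` B i))%E.

End independence.

(* A process is a function of a time t : R and an outcome w; only the times
   t >= 0 are ever constrained or used. *)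
Section processes.
Context d (T : measurableType d) (R : realType) (P : probability T R).

Definition times : set R := `[0, +oo[.

(* A finite sequence of times extends to a nondecreasing infinite one by
   repeating its last term, so this covers the increments along finite
   sequences. *)
Definition independent_increments (X : R -> T -> R) :=
  forall t : nat -> R, 0 <= t 0%N -> nondecreasing_seq t ->
    mutually_independent P setT (fun i w => X (t i.+1) w - X (t i) w).

Record poisson_process (rate : R) (N : R -> T -> nat) : Prop := {
  poisson_measurable : forall t : R, 0 <= t -> measurable_fun setT (N t) ;
  poisson_start : forall w, N 0 w = 0%N ;
  poisson_nondecreasing :
    forall w (s t : R), 0 <= s -> s <= t -> (N s w <= N t w)%N ;
  poisson_right_continuous : forall w (t : R), 0 <= t ->
    (N x w)%:R @[x --> t^'+] --> ((N t w)%:R : R) ;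
  poisson_independent_increments :
    independent_increments (fun t w => (N t w)%:R) ;
  poisson_increment : forall (s t : R) n, 0 <= s -> s < t ->
    P [set w | (N t w - N s w)%N = n] = (poisson_pmf (rate * (t - s)) n)%:E
}.

Record iid_uniform (k : nat) (X : nat -> T -> nat) : Prop := {
  iid_measurable : forall i, (1 <= i)%N -> measurable_fun setT (X i) ;
  iid_independent : mutually_independent P [set i | (1 <= i)%N] X ;
  iid_law : forall i j, (1 <= i)%N ->
    P [set w | X i w = j] = (if (1 <= j <= k)%N then k%:R^-1 else 0)%:E
}.

Definition is_PPoK (k : nat) (lambda : R) (Nk : R -> T -> nat) : Prop :=
  exists (N : R -> T -> nat) (X : nat -> T -> nat),
    [/\ poisson_process (k%:R * lambda) N,
        iid_uniform k X,
        independent_families P [set i | (1 <= i)%N] X times N &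
        forall (t : R) w, 0 <= t -> Nk t w = (\sum_(1 <= i < (N t w).+1) X i w)%N].

Definition is_SPoK (k : nat) (lambda1 lambda2 : R) (Sk : R -> T -> int) : Prop :=
  exists N1 N2 : R -> T -> nat,
    [/\ is_PPoK k lambda1 N1,
        is_PPoK k lambda2 N2,
        independent_families P times N1 times N2 &
        forall (t : R) w, 0 <= t -> Sk t w = (N1 t w)%:Z - (N2 t w)%:Z].

Record stable_subordinator (alpha : R) (D : R -> T -> R) : Prop := {
  stable_measurable : forall t : R, 0 <= t -> measurable_fun setT (D t) ;
  stable_start : forall w, D 0 w = 0 ;
  stable_nondecreasing : forall w (s t : R), 0 <= s -> s <= t -> D s w <= D t w ;
  stable_right_continuous : forall w (t : R), 0 <= t ->
    D x w @[x --> t^'+] --> D t w ;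
  stable_independent_increments : independent_increments D ;
  stable_stationary_increments : forall (s t : R) (B : set R),
    0 <= s -> s <= t -> measurable B ->
    P [set w | B (D t w - D s w)] = P [set w | B (D (t - s) w)] ;
  stable_laplace : forall s t : R, 0 < s -> 0 <= t ->
    ('E_P [fun w => expR (- s * D t w)] = (expR (- t * s `^ alpha))%:E)%E
}.

(* inf set0 = 0 here; the set is empty only on a null event, since a stable
   subordinator is almost surely unbounded. *)
Definition inverse_subordinator (D : R -> T -> R) (t : R) (w : T) : R :=
  inf [set r | 0 <= r /\ t < D r w].

Definition is_FSPoK (k : nat) (lambda1 lambda2 alpha : R)
    (S : R -> T -> int) : Prop :=
  if alpha == 1 then is_SPoK k lambda1 lambda2 S
  else exists (Sk : R -> T -> int) (D : R -> T -> R),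
    [/\ is_SPoK k lambda1 lambda2 Sk,
        stable_subordinator alpha D,
        independent_families P times (inverse_subordinator D) times Sk &
        forall (t : R) w, 0 <= t -> S t w = Sk (inverse_subordinator D t w) w].

Definition state_probability (S : R -> T -> int) (n : int) (t : R) : R :=
  fine (P [set w | S t w = n]).

End processes.

Section caputo.
Context (R : realType).
Local Notation mu := (@lebesgue_measure R).

Definition Gamma (a : R) : R :=
  \int[mu]_(x in `]0, +oo[) (x `^ (a - 1) * expR (- x)).

Definition caputo_integrand (alpha : R) (f : R -> R) (t s : R) : R :=
  (t - s) `^ (- alpha) * derive1 f s.

Definition caputo (alpha : R) (f : R -> R) (t : R) : R :=
  if alpha == 1 then derive1 f t
  else (Gamma (1 - alpha))^-1 * \int[mu]_(s in `]0, t[) caputo_integrand alpha f t s.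

(* The derivative and the integral above are total functions with junk values;
   this says that they are meaningful. *)
Definition ex_caputo (alpha : R) (f : R -> R) (t : R) : Prop :=
  if alpha == 1 then derivable f t 1
  else (forall s : R, 0 < s < t -> derivable f s 1) /\
       mu.-integrable `]0, t[ (EFin \o caputo_integrand alpha f t).

End caputo.

(* Main.v *)
From HB Require Import structures.
Require Import Defs.
From mathcomp Require Import all_boot all_order all_algebra.
From mathcomp Require Import finmap.
From mathcomp Require Import all_classical all_reals all_analysis.
From mathcomp Require Import measurable_realfun.
From mathcomp Require Import ring lra.
Import Order.TTheory GRing.Theory Num.Theory.
Import numFieldNormedType.Exports.
Local Open Scope classical_set_scope.
Local Open Scope ring_scope.
Set Implicit Arguments.
Unset Strict Implicit.
Unset Printing Implicit Defensive.

(** Everything reduces to power series.  Write A for the bounded operator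
    acting on functions of the state,
      (A f) n = - k (lambda1 + lambda2) f n
                + lambda1 sum_(1 <= j <= k) f (n - j)
                + lambda2 sum_(1 <= j <= k) f (n + j),
    and a_m = A^m delta_0.  The state probabilities turn out to be
      p(n, t) = sum_m a_m(n) t^(alpha m) / Gamma(alpha m + 1)   (FSPoK_law),
    a Mittag-Leffler function of A.  Since |a_m(n)| <= C^m, this series may be
    differentiated term by term, and the Caputo derivative sends
    t^(alpha m) / Gamma(alpha m + 1) to
    t^(alpha (m - 1)) / Gamma(alpha (m - 1) + 1), by the Beta integral
    (beta_integral).  It therefore shifts the coefficients (caputo_series),
    which is the same as applying A to them, and this is the equation.

    The series is obtained in three steps.

    For alpha = 1 (SPoK_law), condition on the two Poisson counts.  Given m1
    and m2 jumps, the law of the position is U^m1 V^m2 delta_0, where U and V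
    average over the k unit shifts upwards and downwards.  The Poisson-weighted
    double sum is then summed along diagonals; as U and V commute, the binomial
    formula turns it into the exponential series of A (skellam_series).

    For alpha < 1, the process is the previous one run with the independent
    clock Y, so p(n, t) is the expectation of q(n, Y t) with q the law for
    alpha = 1 (time_change); the random time is approximated from above by
    a countably valued one, and right-continuity of the paths passes to the
    limit.

    Finally the moments of the clock are E (Y t)^m =
    t^(alpha m) m! / Gamma(alpha m + 1) (inverse_moment).  The Laplace
    transform determines the law of D r (laplace_cdf, a consequence of Bernstein
    approximation), which gives the scaling D r = r^(1/alpha) D 1 in law;
    as Y is the inverse of D, Y t has the law of (t / D 1)^alpha
    (inverse_tail); and the negative moments of D 1 come from integrating its
    Laplace transform against a power (negative_moment).  Summing the expansion
    of q against these moments gives the series. *)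

(** * Affine substitution and improper integrals on the half-line *)
Section affine.
Context {R : realType}.
Local Notation mu := (@lebesgue_measure R).

(** The image of Lebesgue measure by an increasing affine map is determined by
    its values on half-open intervals.  The substitution thus holds for
    measurable integrands, such as those below, which are singular at the ends
    of their supports. *)
Lemma ge0_integral_affine (c b : R) (f : R -> \bar R) : 0 < c ->
  measurable_fun setT f -> (forall x, 0 <= f x)%E ->
  (\int[mu]_x f x = c%:E * \int[mu]_x f (c * x + b)%R)%E.
Proof.
move=> c0 mf f0.
pose phi (x : measurableTypeR R) : measurableTypeR R := c * x + b.
have mphi : @measurable_fun _ _ (measurableTypeR R) (measurableTypeR R) setT phi.
  by apply: measurable_funD => //; exact: measurable_funM.
pose nu0 :=
  measure_function_pushforward__canonical__measure_function_Measure mu mphi.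
pose nu := mscale (NngNum (ltW c0)) nu0.
have nuE A : measurable A -> mu A = nu A.
  apply: lebesgue_measure_unique => /= _ [[u v] _ <-].
  rewrite /nu /mscale/= /pushforward.
  have -> : phi @^-1` `]u, v]%classic = `](u - b) / c, (v - b) / c]%classic.
    apply/seteqP; split => x/=; rewrite /phi !in_itv/= ltr_pdivrMr// ler_pdivlMr//;
      by rewrite ltrBlDr lerBrDr (mulrC x).
  rewrite !lebesgue_measure_itv/= !lte_fin ltr_pM2r ?invr_gt0// ltrD2r.
  case: ifPn => uv; last by rewrite mule0.
  rewrite -!EFinB -EFinM; congr EFin.
  by field; rewrite gt_eqF.
rewrite (eq_measure_integral nu); last by move=> A mA _; exact: nuE.
rewrite ge0_integral_mscale//=; congr (_ * _)%E.
rewrite (@ge0_integral_pushforward _ _ _ _ _ _ mphi mu setT f)// .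
Qed.

End affine.

(** The fundamental theorem of calculus for a nonnegative integrand which may
    be singular at 0, such as x^(a - 1): only the limit at 0 of a primitive
    matters. *)
Section improper_FTC.
Context {R : realType}.
Local Notation mu := (@lebesgue_measure R).
Variables (f F : R -> R) (l0 : R).
Hypothesis f0 : forall x : R, 0 < x -> 0 <= f x.
Hypothesis cf : forall x : R, 0 < x -> {for x, continuous f}.
Hypothesis dF : forall x : R, 0 < x -> is_derive x 1 F (f x).
Hypothesis F0 : F x @[x --> 0^'+] --> l0.

Let cF (x : R) : 0 < x -> {for x, continuous F}.
Proof.
move=> x0; apply: differentiable_continuous; apply/derivable1_diffP.
by have [] := dF x0.
Qed.

Lemma measurable_fun_gt0 : measurable_fun (`]0, +oo[ : set R) (EFin \o f).
Proof.
apply/measurable_EFinP; apply: open_continuous_measurable_fun => //.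
by move=> x; rewrite inE/= in_itv/= andbT => x0; exact: cf.
Qed.

Let cvg0 (a : R^nat) : (forall n, 0 < a n) -> a @ \oo --> (0 : R) ->
  F (a n) @[n --> \oo] --> l0.
Proof.
move=> a0 acvg; move/cvg_at_rightP : F0; apply; split => //.
Qed.

Lemma ge0_FTC_0y (ly : R) : F x @[x --> +oo] --> ly ->
  (\int[mu]_(x in `]0%R, +oo[) (f x)%:E = ly%:E - l0%:E)%E.
Proof.
move=> Fy.
pose a (n : nat) : R := n.+1%:R^-1.
have a0 n : 0 < a n by rewrite invr_gt0.
have acvg : a @ \oo --> (0 : R) by exact: cvg_harmonic.
have aE : `]0, +oo[%classic = \bigcup_n `[a n, +oo[%classic :> set R.
  apply/seteqP; split => x /=; last first.
    by move=> [n _]/=; rewrite !in_itv/= !andbT; apply: lt_le_trans.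
  rewrite in_itv/= andbT => x0.
  have : \forall n \near \oo, a n < x.
    by move/cvgr_lt : acvg; apply.
  by move=> [N _ /(_ N (leqnn _))/= h]; exists N => //=; rewrite in_itv/= andbT ltW.
have c1 : (\int[mu]_(x in `[a n, +oo[) (f x)%:E)%E @[n --> \oo] -->
    (\int[mu]_(x in `]0%R, +oo[) (f x)%:E)%E.
  rewrite aE; apply: ge0_nondecreasing_set_cvg_integral => //.
  - move=> m n mn; apply/subsetPset => x /=; rewrite !in_itv/= !andbT.
    by apply: le_trans; rewrite lef_pV2 ?posrE// ler_nat.
  - move=> n; apply: measurable_funS measurable_fun_gt0 => //.
    by move=> x /=; rewrite !in_itv/= !andbT; apply: lt_le_trans.
  - move=> n x /=; rewrite in_itv/= andbT lee_fin => anx; apply: f0.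
    exact: lt_le_trans anx.
have c2 : (\int[mu]_(x in `[a n, +oo[) (f x)%:E)%E @[n --> \oo] --> (ly%:E - l0%:E)%E.
  rewrite (_ : (fun n => _) = (fun n => (ly - F (a n))%:E)); last first.
    apply/funext => n; rewrite (@ge0_continuous_FTC2y _ f F (a n) ly)// ?EFinB//.
    - by move=> x ax; apply: f0; exact: lt_le_trans ax.
    - apply: continuous_in_subspaceT => x; rewrite inE/= in_itv/= andbT => ax.
      by apply: cf; exact: lt_le_trans ax.
    - by move=> x ax; have [] := dF (lt_trans (a0 n) ax).
    - by apply: cvg_at_right_filter; exact: cF.
    - move=> x; rewrite in_itv/= andbT => ax.
      by rewrite derive1E; have [_ ->] := dF (lt_trans (a0 n) ax).
  rewrite -EFinB; apply/fine_cvgP; split; first exact: nearW.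
  by apply: cvgB; [exact: cvg_cst|exact: cvg0].
by move: c1 c2 => /cvg_lim <-// /cvg_lim <-.
Qed.

Lemma ge0_FTC_0b (b : R) : 0 < b ->
  (\int[mu]_(x in `]0%R, b[) (f x)%:E = (F b)%:E - l0%:E)%E.
Proof.
move=> b0.
rewrite integral_itv_bndo_bndc; last first.
  by apply: measurable_funS measurable_fun_gt0 => // x/=; rewrite !in_itv/= andbT => /andP[].
pose a (n : nat) : R := b * n.+2%:R^-1.
have a0 n : 0 < a n by rewrite mulr_gt0// invr_gt0.
have acvg : a @ \oo --> (0 : R).
  rewrite -[0](mulr0 b); apply: cvgM; first exact: cvg_cst.
  by rewrite (cvg_shiftS (fun n => n.+1%:R^-1 : R)); exact: cvg_harmonic.
have ab n : a n < b by rewrite gtr_pMr// invf_lt1// ltr1n.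
have aE : `]0, b]%classic = \bigcup_n `[a n, b]%classic :> set R.
  apply/seteqP; split => x /=; last first.
    move=> [n _]/=; rewrite !in_itv/= => /andP[anx ->]; rewrite andbT.
    by apply: lt_le_trans anx.
  rewrite in_itv/= => /andP[x0 xb].
  have : \forall n \near \oo, a n < x.
    by move/cvgr_lt : acvg; apply.
  by move=> [N _ /(_ N (leqnn _))/= h]; exists N => //=; rewrite in_itv/= xb andbT ltW.
have c1 : (\int[mu]_(x in `[a n, b]) (f x)%:E)%E @[n --> \oo] -->
    (\int[mu]_(x in `]0%R, b]) (f x)%:E)%E.
  rewrite aE; apply: ge0_nondecreasing_set_cvg_integral => //.
  - move=> m n mn; apply/subsetPset => x /=; rewrite !in_itv/= => /andP[h ->]; rewrite andbT.
    by apply: le_trans h; rewrite ler_pM2l// lef_pV2 ?posrE// ler_nat.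
  - move=> n; apply: measurable_funS measurable_fun_gt0 => //.
    by move=> x /=; rewrite !in_itv/= !andbT => /andP[+ _]; apply: lt_le_trans.
  - move=> n x /=; rewrite in_itv/= lee_fin => /andP[anx _]; apply: f0.
    exact: lt_le_trans anx.
have c2 : (\int[mu]_(x in `[a n, b]) (f x)%:E)%E @[n --> \oo] --> ((F b)%:E - l0%:E)%E.
  rewrite (_ : (fun n => _) = (fun n => (F b - F (a n))%:E)); last first.
    apply/funext => n; rewrite (@continuous_FTC2 _ f F (a n) b)// ?EFinB//.
    - apply: continuous_in_subspaceT => x; rewrite inE/= in_itv/= => /andP[ax _].
      by apply: cf; exact: lt_le_trans ax.
    - split.
      + by move=> x; rewrite in_itv/= => /andP[ax _]; have [] := dF (lt_trans (a0 n) ax).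
      + by apply: cvg_at_right_filter; exact: cF.
      + by apply: cvg_at_left_filter; exact: cF.
    - move=> x; rewrite in_itv/= => /andP[ax _].
      by rewrite derive1E; have [_ ->] := dF (lt_trans (a0 n) ax).
  rewrite -EFinB; apply/fine_cvgP; split; first exact: nearW.
  by apply: cvgB; [exact: cvg_cst|exact: cvg0].
by move: c1 c2 => /cvg_lim <-// /cvg_lim <-.
Qed.

End improper_FTC.

(** * Integrals of powers against exponentials *)
Section stretched_exponential.
Context {R : realType}.
Local Notation mu := (@lebesgue_measure R).

(** Up to the factor m!, the incomplete Gamma function of m + 1: its derivative
    telescopes to a single term. *)
Let h m (u : R) := expR (- u) * \sum_(j < m.+1) u ^+ j / j`!%:R.

Let h_derive m (u : R) : is_derive u 1 (h m) (- (expR (- u) * u ^+ m / m`!%:R)).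
Proof.
elim: m => [|m IH].
  have -> : h 0%N = (fun u => expR (- u)).
    by apply/funext => v; rewrite /h big_ord1 expr0 fact0 divr1 mulr1.
  have -> : - (expR (- u) * u ^+ 0 / 0`!%:R) = expR (- u) * -1.
    by rewrite expr0 fact0; field.
  exact: is_derive1_comp.
have -> : h m.+1 = h m + m.+1`!%:R^-1 *: ((fun u => expR (- u)) * (@id R ^+ m.+1)).
  apply/funext => v; rewrite /h big_ord_recr/= mulrDr.
  rewrite addrfctE scalrfctE mulrfctE exprfctE /=.
  by congr (_ + _); rewrite /GRing.scale/=; ring.
have E : is_derive u 1 (fun u : R => expR (- u)) (expR (- u) * -1) by exact: is_derive1_comp.
apply: is_derive_eq.
rewrite exprfctE /GRing.scale/= factS natrM exprS.
have : (m`!)%:R != 0 :> R by rewrite pnatr_eq0 -lt0n fact_gt0.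
have : (m.+1)%:R != 0 :> R by rewrite pnatr_eq0.
by move=> ? ?; field; apply/andP.
Qed.

Let expRN_exprn_cvgy j : expR (- u) * (u ^+ j / j`!%:R) @[u --> +oo] --> (0 : R).
Proof.
apply: (@squeeze_cvgr _ _ _ _ (cst 0) (fun u => j.+1%:R * u^-1)).
- near=> u.
  have u0 : 0 < u by near: u; exact: nbhs_pinfty_gt.
  have f0 : 0 < (j`!)%:R :> R by rewrite ltr0n fact_gt0.
  apply/andP; split.
    by rewrite /= mulr_ge0 ?expR_ge0// divr_ge0// exprn_ge0// ltW.
  have := expR_ge1Dxn j (ltW u0) => H.
  have {}H : u ^+ j.+1 / j.+1`!%:R <= expR u by apply: le_trans H; rewrite lerDr.
  rewrite expRN [leLHS]mulrC ler_pdivrMr ?expR_gt0//.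
  have -> : u ^+ j / j`!%:R = j.+1%:R / u * (u ^+ j.+1 / j.+1`!%:R).
    by rewrite factS natrM exprS; field; rewrite nat1r !gt_eqF.
  by rewrite ler_pM2l// divr_gt0.
- exact: cvg_cst.
- rewrite -[0](mulr0 (j.+1%:R : R)); apply: cvgM; first exact: cvg_cst.
  apply/gtr0_cvgV0; last exact: cvg_id.
  by near=> u; near: u; exact: nbhs_pinfty_gt.
Unshelve. all: by end_near. Qed.

Let h_cvgy m : h m u @[u --> +oo] --> (0 : R).
Proof.
elim: m => [|m IH].
  apply: cvg_trans (expRN_exprn_cvgy 0); apply: near_eq_cvg; apply: nearW => u.
  by rewrite /h big_ord1.
rewrite -[0]addr0.
apply: cvg_trans (cvgD IH (expRN_exprn_cvgy m.+1)).
apply: near_eq_cvg; apply: nearW => u.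
by rewrite /h [in RHS]big_ord_recr/= mulrDr.
Qed.

Lemma powR_cvgy (a : R) : 0 < a -> s `^ a @[s --> +oo] --> +oo.
Proof.
move=> a0; apply/cvgryPge => A.
near=> s.
have s0 : 0 < s by near: s; exact: nbhs_pinfty_gt.
have [A0|A0] := leP A 0; first by rewrite (le_trans A0)// powR_ge0.
have As : A `^ a^-1 <= s by near: s; apply: nbhs_pinfty_ge; exact: num_real.
have : (A `^ a^-1) `^ a <= s `^ a.
  by apply: ge0_ler_powR => //; rewrite ?nnegrE ?powR_ge0// ltW.
by rewrite -powRrM mulVf ?gt_eqF// powRr1// ltW.
Unshelve. all: by end_near. Qed.

Lemma powR_continuous (a x : R) : 0 < x -> {for x, continuous (@powR R ^~ a)}.
Proof.
move=> x0; apply: differentiable_continuous; apply/derivable1_diffP.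
by apply: derivable_powR; rewrite in_itv/= andbT.
Qed.

(** Up to the factor 1 / a, the integral of u^m exp(-u) after the substitution
    u = s^a; the primitive is explicit because m is a natural number. *)
Lemma integral_powR_expR_powR (a : R) (m : nat) : 0 < a ->
  (\int[mu]_(s in `]0%R, +oo[) (s `^ (a * m.+1%:R - 1) * expR (- (s `^ a)))%:E =
   (m`!%:R / a)%:E)%E.
Proof.
move=> a0.
have mfact_gt0 : 0 < (m`!)%:R :> R by rewrite ltr0n fact_gt0.
pose F s := - (m`!%:R / a) * h m (s `^ a).
have cE : forall x : R, 0 < x -> {for x, continuous (fun s => expR (- (s `^ a)))}.
  move=> x x0; apply: continuous_comp; last exact: continuous_expR.
  by apply: continuousN; exact: powR_continuous.
rewrite (@ge0_FTC_0y _ _ F (- (m`!%:R / a)) _ _ _ _ 0).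
- by rewrite -EFinB sub0r opprK.
- by move=> x x0; rewrite mulr_ge0 ?powR_ge0 ?expR_ge0.
- move=> x x0; apply: continuousM; [exact: powR_continuous|exact: cE].
- move=> x x0.
  have D1 := is_derive1_powR a x0.
  have D2 := @is_derive1_comp _ (h m) (@powR R ^~ a) x _ _ (h_derive m _) D1.
  have -> : F = - (m`!%:R / a) *: (h m \o (@powR R ^~ a)) by [].
  apply: is_derive_eq.
  rewrite /GRing.scale/=.
  have -> : x `^ (a * m.+1%:R - 1) = x `^ (a - 1) * (x `^ a) ^+ m.
    rewrite -powR_mulrn ?powR_ge0// -powRrM -powRD; last by rewrite (gt_eqF x0) implybT.
    by congr powR; rewrite -natr1; ring.
  by field; rewrite !gt_eqF.
- rewrite -[X in _ --> X]mulr1; apply: cvgM; first exact: cvg_cst.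
  apply: (@cvg_comp _ _ _ (fun s => s `^ a) (h m) _ (nbhs (0:R))).
    exact: powR_cvg0.
  have -> : 1 = h m 0.
    rewrite /h oppr0 expR0 mul1r big_ord_recl/= expr0 fact0 divr1 big1 ?addr0// => i _.
    by rewrite exprS mul0r mul0r.
  apply: differentiable_continuous; apply/derivable1_diffP.
  by have [] := h_derive m 0.
- rewrite -[X in _ --> X](mulr0 (- (m`!%:R / a))); apply: cvgM; first exact: cvg_cst.
  by apply: cvg_comp (h_cvgy m); exact: powR_cvgy.
Qed.

Lemma integral_powR_0b (a b : R) : 0 < a -> 0 < b ->
  (\int[mu]_(s in `]0%R, b[) (s `^ (a - 1))%:E = (b `^ a / a)%:E)%E.
Proof.
move=> a0 b0.
rewrite (@ge0_FTC_0b _ _ (fun s => s `^ a / a) 0 _ _ _ _ _ b0).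
- by rewrite sube0.
- by move=> x x0; rewrite powR_ge0.
- by move=> x x0; exact: powR_continuous.
- move=> x x0.
  have D1 := is_derive1_powR a x0.
  have -> : (fun s : R => s `^ a / a) = a^-1 *: (@powR R ^~ a).
    by apply/funext => s; rewrite mulrC.
  apply: is_derive_eq.
  by rewrite /GRing.scale/=; field; rewrite gt_eqF.
- rewrite -[X in _ --> X](mul0r a^-1); apply: cvgM; last exact: cvg_cst.
  exact: powR_cvg0.
Qed.

End stretched_exponential.

(** * The Gamma and Beta integrals *)
Section gamma_beta.
Context {R : realType}.
Local Notation mu := (@lebesgue_measure R).

(** The integrands are extended by 0 to the whole line, where translations and
    dilations act, and the integrals are kept in the extended reals, where
    Tonelli applies before anything is known to be finite. *)
Definition gamma_kernel (a x : R) : R :=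
  if 0 < x then x `^ (a - 1) * expR (- x) else 0.

Definition beta_kernel (a b t s : R) : R :=
  if (0 < s) && (s < t) then (t - s) `^ (a - 1) * s `^ (b - 1) else 0.

Definition egamma (a : R) : \bar R := (\int[mu]_x (gamma_kernel a x)%:E)%E.

Definition ebeta (a b t : R) : \bar R := (\int[mu]_s (beta_kernel a b t s)%:E)%E.

Lemma gamma_kernel_ge0 a x : 0 <= gamma_kernel a x.
Proof. by rewrite /gamma_kernel; case: ifP => // _; rewrite mulr_ge0 ?powR_ge0 ?expR_ge0. Qed.

Lemma beta_kernel_ge0 a b t s : 0 <= beta_kernel a b t s.
Proof. by rewrite /beta_kernel; case: ifP => // _; rewrite mulr_ge0 ?powR_ge0. Qed.

Lemma measurable_gamma_kernel a : measurable_fun setT (gamma_kernel a).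
Proof.
apply: measurable_fun_ifT => //; first exact: measurable_fun_ltr.
apply: measurable_funM; first exact: measurable_powR.
by apply: measurableT_comp => //; exact: measurable_funN.
Qed.

Lemma integral_gamma_kernel a :
  (\int[mu]_(x in `]0%R, +oo[) (x `^ (a - 1) * expR (- x))%:E = egamma a)%E.
Proof.
rewrite integral_mkcond; apply: eq_integral => x _.
rewrite patchE /gamma_kernel; case: ifPn => [|].
  by rewrite inE/= in_itv/= andbT => ->.
by rewrite notin_setE/= in_itv/= andbT => /negP/negbTE ->.
Qed.

Lemma integral_beta_kernel a b t :
  (\int[mu]_(s in `]0%R, t[) ((t - s) `^ (a - 1) * s `^ (b - 1))%:E = ebeta a b t)%E.
Proof.
rewrite integral_mkcond; apply: eq_integral => x _.
rewrite patchE /beta_kernel; case: ifPn => [|].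
  by rewrite inE/= in_itv/= => ->.
by rewrite notin_setE/= in_itv/= => /negP/negbTE ->.
Qed.

Lemma measurable_beta_kernel a b t : measurable_fun setT (beta_kernel a b t).
Proof.
apply: measurable_fun_ifT => //.
  by apply: measurable_and; exact: measurable_fun_ltr.
apply: measurable_funM; last exact: measurable_powR.
apply: (measurableT_comp (measurable_powR _)).
exact: measurable_funB.
Qed.

Lemma ebeta_scale a b t : 0 < t -> ebeta a b t = ((t `^ (a + b - 1))%:E * ebeta a b 1)%E.
Proof.
move=> t0; rewrite /ebeta (@ge0_integral_affine _ t 0) //; last 2 first.
  - by apply/measurable_EFinP; exact: measurable_beta_kernel.
  - by move=> x; rewrite lee_fin beta_kernel_ge0.
under eq_integral => x _.
  rewrite (_ : beta_kernel a b t _ = t `^ (a + b - 2) * beta_kernel a b 1 x); last first.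
    rewrite /beta_kernel addr0 pmulr_rgt0// gtr_pMr//.
    case: ifPn => [/andP[x0 x1]|]; last by rewrite mulr0.
    rewrite -[X in X - t * x]mulr1 -mulrBr !powRM ?subr_ge0 ?(ltW t0) ?ltW//.
    have -> : a + b - 2 = (a - 1) + (b - 1) by ring.
    by rewrite [in RHS]powRD; [ring|rewrite (gt_eqF t0) implybT].
  rewrite EFinM.
  over.
rewrite /= ge0_integralZl//; last 3 first.
  - by apply/measurable_EFinP; exact: measurable_beta_kernel.
  - by move=> x _; rewrite lee_fin beta_kernel_ge0.
  - by rewrite lee_fin powR_ge0.
rewrite muleA -EFinM; congr (_%:E * _)%E.
rewrite -[X in X * _](powRr1 (ltW t0)) -powRD; last by rewrite (gt_eqF t0) implybT.
by congr powR; ring.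
Qed.

(** Gamma(a) Gamma(b) is the total mass of the convolution of the two Gamma
    kernels, and that convolution at t is exp(-t) times the Beta integral over
    the interval from 0 to t. *)
Lemma egammaM a b : (egamma a * egamma b = egamma (a + b) * ebeta a b 1)%E.
Proof.
transitivity (\int[mu]_s \int[mu]_t (gamma_kernel b s * gamma_kernel a (t - s))%:E)%E.
  rewrite {2}/egamma -ge0_integralZl//; last 3 first.
    - by apply/measurable_EFinP; exact: measurable_gamma_kernel.
    - by move=> x _; rewrite lee_fin gamma_kernel_ge0.
    - by apply: integral_ge0 => x _; rewrite lee_fin gamma_kernel_ge0.
  apply: eq_integral => s _.
  under [RHS]eq_integral do rewrite EFinM.
  rewrite ge0_integralZl//; last 3 first.
    - apply/measurable_EFinP/measurableT_comp; first exact: measurable_gamma_kernel.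
      exact: measurable_funB.
    - by move=> x _; rewrite lee_fin gamma_kernel_ge0.
    - by rewrite lee_fin gamma_kernel_ge0.
  rewrite muleC; congr (_ * _)%E.
  rewrite /egamma (@ge0_integral_affine _ 1 (- s)) //; last 2 first.
    - by apply/measurable_EFinP; exact: measurable_gamma_kernel.
    - by move=> x; rewrite lee_fin gamma_kernel_ge0.
  by rewrite mul1e; apply: eq_integral => t _; rewrite mul1r.
rewrite (@fubini_tonelli _ _ _ _ _ mu mu
  (fun z => (gamma_kernel b z.1 * gamma_kernel a (z.2 - z.1))%:E)); last 2 first.
  - apply/measurable_EFinP/measurable_funM.
      by apply: measurableT_comp => //; exact: measurable_gamma_kernel.
    apply: measurableT_comp; first exact: measurable_gamma_kernel.
    by apply: measurable_funB.
  - by move=> z; rewrite lee_fin mulr_ge0 ?gamma_kernel_ge0.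
rewrite /= [RHS]muleC /egamma -ge0_integralZl//; last 3 first.
  - by apply/measurable_EFinP; exact: measurable_gamma_kernel.
  - by move=> x _; rewrite lee_fin gamma_kernel_ge0.
  - by apply: integral_ge0 => x _; rewrite lee_fin beta_kernel_ge0.
apply: eq_integral => t _.
have [t0|t0] := ltP 0 t; last first.
  rewrite [in RHS]/gamma_kernel ltNge t0 mule0.
  apply: integral0_eq => s _.
  rewrite /gamma_kernel subr_gt0.
  case: ifPn => s0; last by rewrite mul0r.
  by rewrite ifF ?mulr0//; apply/negbTE; rewrite -leNgt (le_trans t0)// ltW.
under eq_integral => s _.
  rewrite (_ : _ * _ = expR (- t) * beta_kernel a b t s); last first.
    rewrite /gamma_kernel /beta_kernel subr_gt0.
    case: ifPn => s0/=; last by rewrite mul0r mulr0.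
    case: ifPn => st; last by rewrite !mulr0.
    have -> : expR (- t) = expR (- s) * expR (- (t - s)).
      by rewrite -expRD; congr expR; ring.
    by ring.
  rewrite EFinM; over.
rewrite /= ge0_integralZl//; last 2 first.
  - by apply/measurable_EFinP; exact: measurable_beta_kernel.
  - by move=> x _; rewrite lee_fin beta_kernel_ge0.
rewrite -/(ebeta a b t) ebeta_scale// /gamma_kernel t0 muleA [RHS]muleC; congr (_ * _)%E.
by rewrite -EFinM mulrC.
Qed.

Lemma egamma_nat m : egamma m.+1%:R = m`!%:R%:E.
Proof.
have := @integral_powR_expR_powR R 1 m ltr01.
rewrite divr1 => <-; rewrite -integral_gamma_kernel.
apply: eq_integral => x; rewrite inE/= in_itv/= andbT => x0.
by rewrite mul1r powRr1// ltW.
Qed.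

(** The case a = 1 of the product formula, where the Beta integral is 1 / b. *)
Lemma egammaS b : 0 < b -> (egamma b = egamma (b + 1) * (b^-1)%:E)%E.
Proof.
move=> b0.
have := egammaM 1 b.
rewrite (egamma_nat 0) fact0 mul1e addrC => ->; congr (_ * _)%E.
rewrite -integral_beta_kernel.
under eq_integral do rewrite subrr powRr0 mul1r.
by rewrite integral_powR_0b// powR1 mul1r.
Qed.

Lemma egamma_ge0 a : (0 <= egamma a)%E.
Proof. by apply: integral_ge0 => x _; rewrite lee_fin gamma_kernel_ge0. Qed.

(** The functional equation reduces to arguments at least 1, where the kernel is
    bounded by the sum of two kernels with integer parameters. *)
Lemma egamma_lty a : 0 < a -> (egamma a < +oo)%E.
Proof.
suff H x : 0 <= x -> (egamma (x + 1) < +oo)%E.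
  move=> a0; rewrite egammaS// lte_mul_pinfty ?egamma_ge0//.
    by rewrite ge0_fin_numE ?egamma_ge0// H// ltW.
  by rewrite ltry.
move=> x0.
pose n := (Num.truncn x).+1.
have xn : x <= n%:R by rewrite ltW// truncnS_gt.
apply: (@le_lt_trans _ _ (egamma 1 + egamma n.+1%:R)%E); last first.
  by rewrite (egamma_nat 0) egamma_nat -EFinD ltry.
rewrite -ge0_integralD//.
  apply: ge0_le_integral => //.
  - by move=> y _; rewrite lee_fin gamma_kernel_ge0.
  - by apply/measurable_EFinP; exact: measurable_gamma_kernel.
  - by apply: emeasurable_funD; apply/measurable_EFinP; exact: measurable_gamma_kernel.
  - move=> y _; rewrite -EFinD lee_fin /gamma_kernel; case: ifPn => [y0|_]; last by rewrite addr0.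
    rewrite -mulrDl ler_pM2r ?expR_gt0// addrK subrr powRr0 -natr1 addrK.
    have [y1|y1] := leP 1 y.
      by rewrite ler_wpDl// ler_powR.
    by rewrite ler_wpDr ?powR_ge0// -(powRr0 y) ger_powR// y0/= ltW.
- by move=> y _; rewrite lee_fin gamma_kernel_ge0.
- by apply/measurable_EFinP; exact: measurable_gamma_kernel.
- by move=> y _; rewrite lee_fin gamma_kernel_ge0.
- by apply/measurable_EFinP; exact: measurable_gamma_kernel.
Qed.

Lemma egammaE a : 0 < a -> egamma a = (Gamma a)%:E.
Proof.
move=> a0; rewrite /Gamma /Rintegral integral_gamma_kernel fineK//.
by rewrite ge0_fin_numE ?egamma_ge0// egamma_lty.
Qed.

Lemma GammaS (a : R) : 0 < a -> Gamma (a + 1) = a * Gamma a.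
Proof.
move=> a0; have := egammaS a0; rewrite !egammaE ?addr_gt0//.
by rewrite -EFinM => -[->]; field; rewrite gt_eqF.
Qed.

Lemma Gamma_nat m : Gamma (m.+1%:R : R) = m`!%:R.
Proof. by have := egamma_nat m; rewrite egammaE// => -[]. Qed.

(** Restricting the integral to y >= B.  As B is arbitrary, this is growth of
    Gamma(x + 1) faster than any exponential in x. *)
Lemma Gamma_ge (x B : R) : 0 <= x -> 0 < B -> B `^ x * expR (- B) <= Gamma (x + 1).
Proof.
move=> x0 B0; rewrite -lee_fin -egammaE ?ltr_wpDl//.
have cE : continuous (fun y : R => expR (- y)).
  by move=> y; apply: continuous_comp; [apply: cvgN; exact: cvg_id|exact: continuous_expR].
have DE (y : R) : is_derive y 1 (fun y => B `^ x * - expR (- y)) (B `^ x * expR (- y)).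
  have E : is_derive y 1 (fun u : R => expR (- u)) (expR (- y) * -1) by exact: is_derive1_comp.
  have -> : (fun y => B `^ x * - expR (- y)) = B `^ x *: (- (fun u : R => expR (- u))) by [].
  by apply: is_derive_eq; rewrite /GRing.scale/=; ring.
have <- : (\int[mu]_(y in `[B, +oo[) (B `^ x * expR (- y))%:E = (B `^ x * expR (- B))%:E)%E.
  rewrite (@ge0_continuous_FTC2y _ _ (fun y => B `^ x * - expR (- y)) _ 0)//.
  - by rewrite -EFinB sub0r mulrN opprK.
  - by move=> y _; rewrite mulr_ge0 ?powR_ge0 ?expR_ge0.
  - apply: continuous_subspaceT => y.
    by apply: cvgM; [exact: cvg_cst|exact: cE].
  - rewrite -[X in _ --> X](mulr0 (B `^ x)); apply: cvgM; first exact: cvg_cst.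
    by rewrite -oppr0; apply: cvgN; exact: cvgr_expR.
  - apply: cvg_at_right_filter.
    by apply: cvgM; [exact: cvg_cst|apply: cvgN; exact: cE].
  - by move=> y _; rewrite derive1E; have [_ ->] := DE y.
rewrite /egamma integral_mkcond; apply: ge0_le_integral => //.
- move=> y _; rewrite patchE; case: ifP => // _.
  by rewrite lee_fin mulr_ge0 ?powR_ge0 ?expR_ge0.
- apply/(measurable_restrictT _ _).1 => //; apply/measurable_EFinP.
  apply: measurable_funM => //; apply: measurableT_comp => //.
- by apply/measurable_EFinP; exact: measurable_gamma_kernel.
- move=> y _; rewrite patchE; case: ifPn => [|_]; last by rewrite lee_fin gamma_kernel_ge0.
  rewrite inE/= in_itv/= andbT => By.
  rewrite lee_fin /gamma_kernel (lt_le_trans B0 By) ler_pM2r ?expR_gt0// addrK.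
  by apply: ge0_ler_powR; rewrite ?nnegrE// ltW// (lt_le_trans B0).
Qed.

Lemma Gamma_gt0 (a : R) : 0 < a -> 0 < Gamma a.
Proof.
move=> a0; rewrite -(pmulr_rgt0 _ a0) -GammaS//.
apply: lt_le_trans (Gamma_ge (ltW a0) ltr01).
by rewrite powR1 mul1r expR_gt0.
Qed.

Lemma beta_integral (a b t : R) : 0 < a -> 0 < b -> 0 < t ->
  (\int[mu]_(s in `]0%R, t[) ((t - s) `^ (a - 1) * s `^ (b - 1))%:E =
  (t `^ (a + b - 1) * (Gamma a * Gamma b / Gamma (a + b)))%:E)%E.
Proof.
move=> a0 b0 t0; rewrite integral_beta_kernel ebeta_scale// EFinM; congr (_ * _)%E.
have := egammaM a b; rewrite !egammaE ?addr_gt0// -EFinM => E.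
have G0 := Gamma_gt0 (addr_gt0 a0 b0).
by rewrite mulrC EFinM E muleA -EFinM mulVf ?mul1e// gt_eqF.
Qed.

Lemma gamma_laplace (b D : R) : 0 < b -> 0 < D ->
  (\int[mu]_(s in `]0%R, +oo[) (s `^ (b - 1) * expR (- (s * D)))%:E =
  (D `^ (- b) * Gamma b)%:E)%E.
Proof.
move=> b0 D0.
rewrite EFinM -egammaE// /egamma (@ge0_integral_affine _ D 0)//; last 2 first.
  - by apply/measurable_EFinP; exact: measurable_gamma_kernel.
  - by move=> x; rewrite lee_fin gamma_kernel_ge0.
rewrite muleA -EFinM -ge0_integralZl//; last 3 first.
  - apply/measurable_EFinP/measurableT_comp; first exact: measurable_gamma_kernel.
    by apply: measurable_funD => //; exact: measurable_funM.
  - by move=> x _; rewrite lee_fin gamma_kernel_ge0.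
  - by rewrite lee_fin mulr_ge0 ?powR_ge0// ltW.
rewrite [LHS]integral_mkcond; apply: eq_integral => x _.
rewrite patchE /gamma_kernel addr0 pmulr_rgt0//; case: ifPn => [|].
  rewrite inE/= in_itv/= andbT => x0; rewrite x0 -EFinM; congr (_%:E).
  rewrite powRM ?ltW// [D * x]mulrC.
  have H : D `^ (- b) * D * D `^ (b - 1) = 1.
    rewrite -[X in _ * X * _](powRr1 (ltW D0)) -!powRD; last 2 first.
    - by rewrite (gt_eqF D0) implybT.
    - by rewrite (gt_eqF D0) implybT.
    by rewrite (_ : _ + _ = 0) ?powRr0//; ring.
  by rewrite !mulrA H mul1r.
by rewrite notin_setE/= in_itv/= andbT => /negP/negbTE ->; rewrite mule0.
Qed.

End gamma_beta.

(** * The Laplace transform determines the distribution function *)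
Section bounded_convergence.
Context d (T : measurableType d) (R : realType) (P : probability T R).

Lemma bounded_convergence (f_ : nat -> T -> R) (f : T -> R) (M : R) :
  (forall n, measurable_fun setT (f_ n)) ->
  (forall n w, `|f_ n w| <= M) ->
  (forall w, f_ n w @[n --> \oo] --> f w) ->
  (\int[P]_w (f_ n w)%:E)%E @[n --> \oo] --> (\int[P]_w (f w)%:E)%E.
Proof.
move=> mf fM ff.
have mlim : measurable_fun setT f.
  by apply: (measurable_fun_cvg mf) => w _; exact: ff.
have := @dominated_convergence _ T R P setT measurableT (fun n => EFin \o f_ n)
  (EFin \o f) (cst M%:E).
case.
- by move=> n; apply/measurable_EFinP.
- exact/measurable_EFinP.
- by apply: aeW => w _; apply: cvg_EFin; [exact: nearW|exact: ff].
- by apply: finite_measure_integrable_cst.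
- by apply: aeW => w n _ /=; rewrite lee_fin.
- by move=> _ _.
Qed.

End bounded_convergence.

Section bernstein.
Context {R : realType}.

(** The value at u is the expectation of f at a binomial variable with
    parameters n and u.  The recursion conditions on the first trial, which
    makes the moments below computable without binomial coefficients. *)
Fixpoint bernstein (n : nat) (f : nat -> R) : {poly R} :=
  if n is m.+1 then 'X * bernstein m (f \o S) + (1 - 'X) * bernstein m f
  else (f 0%N)%:P.

Lemma bernsteinS n f u : (bernstein n.+1 f).[u] =
  u * (bernstein n (f \o S)).[u] + (1 - u) * (bernstein n f).[u].
Proof. by rewrite /= !hornerE. Qed.

(** The second moment of the binomial law around any centre c; c = n u gives
    the variance. *)
Lemma bernstein_sqr n (c u : R) :
  (bernstein n (fun j => (j%:R - c) ^+ 2)).[u] =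
  (n%:R * u - c) ^+ 2 + n%:R * u * (1 - u).
Proof.
elim: n c => [|n IH] c; first by rewrite /= !hornerE; ring.
rewrite bernsteinS IH (_ : _ \o S = fun j => (j%:R - (c - 1)) ^+ 2); last first.
  by apply/funext => j /=; congr (_ ^+ 2); rewrite -natr1; ring.
by rewrite IH -natr1; ring.
Qed.

Lemma bernstein_lin n (a b : R) f g u :
  (bernstein n (fun j => a * f j + b * g j)).[u] =
  a * (bernstein n f).[u] + b * (bernstein n g).[u].
Proof.
elim: n f g => [|n IH] f g; first by rewrite /= !hornerE.
by rewrite !bernsteinS IH [_ \o S](_ : _ = fun j => a * (f \o S) j + b * (g \o S) j)// IH; ring.
Qed.

Lemma bernstein_cst n (a u : R) : (bernstein n (cst a)).[u] = a.
Proof.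
elim: n => [|n IH]; first by rewrite /= !hornerE.
by rewrite bernsteinS [_ \o S](_ : _ = cst a)// IH; ring.
Qed.

Lemma bernstein_le n f g (u : R) : 0 <= u <= 1 -> (forall j, f j <= g j) ->
  (bernstein n f).[u] <= (bernstein n g).[u].
Proof.
move=> /andP[u0 u1]; elim: n f g => [|n IH] f g fg; first by rewrite /= !hornerE.
rewrite !bernsteinS lerD// ler_wpM2l// ?subr_ge0// IH// => j.
exact: fg.
Qed.

(** Chebyshev in the form |x| <= delta + x^2 / delta, with x the deviation of
    j / n from u. *)
Lemma bernstein_approx (phi : R -> R) (L : R) n (u delta : R) : 0 <= L ->
  (forall x y, `|phi x - phi y| <= L * `|x - y|) -> 0 <= u <= 1 -> 0 < delta ->
  `|(bernstein n.+1 (fun j => phi (j%:R / n.+1%:R))).[u] - phi u| <=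
  L * (delta + (n.+1%:R * delta)^-1).
Proof.
move=> L0 lip u01 d0.
have n0 : 0 < n.+1%:R :> R by rewrite ltr0n.
pose c := n.+1%:R * u.
(* s (j - c)^2 = x^2 / delta for x = j / n.+1 - u *)
pose s := delta^-1 / n.+1%:R ^+ 2.
have key j : `|phi (j%:R / n.+1%:R) - phi u| <= L * delta * 1 + L * s * (j%:R - c) ^+ 2.
  apply: le_trans (lip _ _) _; rewrite -mulrA -[L * s * _]mulrA -mulrDr ler_wpM2l//.
  set x := _ - u; have -> : s * (j%:R - c) ^+ 2 = x ^+ 2 / delta.
    by rewrite /s /x /c; field; rewrite nat1r !gt_eqF.
  rewrite mulr1.
  have [xd|xd] := leP `|x| delta; first by rewrite ler_wpDr// divr_ge0 ?sqr_ge0// ltW.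
  rewrite ler_wpDl ?(ltW d0)//.
  rewrite ler_pdivlMr// -real_normK ?num_real// expr2.
  by rewrite ler_wpM2l// ltW.
have bnd : (bernstein n.+1 (fun j => L * delta * 1 + L * s * (j%:R - c) ^+ 2)).[u] <=
    L * (delta + (n.+1%:R * delta)^-1).
  rewrite (bernstein_lin _ _ _ (cst 1)) bernstein_cst bernstein_sqr /c subrr expr0n/= add0r mulr1.
  rewrite -[L * s * _]mulrA -mulrDr ler_wpM2l// lerD2l.
  have -> : s * (n.+1%:R * u * (1 - u)) = (n.+1%:R * delta)^-1 * (u * (1 - u)).
    by rewrite /s; field; rewrite nat1r !gt_eqF.
  move: u01 => /andP[u0 u1].
  rewrite ler_piMr//; first by rewrite invr_ge0 mulr_ge0 ?(ltW d0).
  by rewrite mulr_ile1 ?subr_ge0// lerBlDr lerDl.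
have E : (bernstein n.+1 (fun j => phi (j%:R / n.+1%:R))).[u] - phi u =
    (bernstein n.+1 (fun j => phi (j%:R / n.+1%:R) - phi u)).[u].
  rewrite (_ : (fun j : nat => _ - phi u) =
    fun j => 1 * phi (j%:R / n.+1%:R) + (- 1) * cst (phi u) j); last first.
    by apply/funext => j /=; ring.
  by rewrite bernstein_lin bernstein_cst; ring.
rewrite E ler_norml; apply/andP; split.
  rewrite lerNl; apply: le_trans bnd.
  rewrite -mulN1r -[_ * _]addr0 -(mul0r (bernstein n.+1 (cst 0)).[u]) -bernstein_lin.
  apply: bernstein_le => // j; apply: le_trans (key j).
  by rewrite mul0r addr0 mulN1r -normrN ler_norm.
apply: le_trans bnd; apply: bernstein_le => // j.
by apply: le_trans (key j); rewrite ler_norm.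
Qed.

Lemma bernstein_cvg (phi : R -> R) (L u : R) : 0 <= L ->
  (forall x y, `|phi x - phi y| <= L * `|x - y|) -> 0 <= u <= 1 ->
  (bernstein n.+1 (fun j => phi (j%:R / n.+1%:R))).[u] @[n --> \oo] --> phi u.
Proof.
move=> L0 lip u01; apply/cvgrPdist_le => e e0.
(* for n large the bound L (delta + 1 / (n.+1 delta)) is at most 2 L delta *)
pose delta := e / (2 * (L + 1)).
have L1 : 0 < L + 1 by rewrite ltr_wpDl.
have d0 : 0 < delta by rewrite divr_gt0// mulr_gt0.
near=> n.
rewrite distrC; apply: le_trans (bernstein_approx n L0 lip u01 d0) _.
apply: (@le_trans _ _ ((L + 1) * (delta + delta))).
  apply: ler_pM => //.
  - apply: addr_ge0; first exact: ltW.
    by rewrite invr_ge0 mulr_ge0// ltW.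
  - by rewrite lerDl.
  rewrite lerD2l invfM ler_pdivrMr//.
  near: n; have /cvgr_le := @cvg_harmonic R; apply.
  by rewrite mulr_gt0.
by rewrite le_eqVlt; apply/orP; left; apply/eqP; rewrite /delta; field; rewrite gt_eqF.
Unshelve. all: by end_near. Qed.

End bernstein.

Section laplace_uniqueness.
Context d (T : measurableType d) (R : realType) (P : probability T R).

Lemma bounded_integrable (f : T -> R) (M : R) : measurable_fun setT f ->
  (forall w, `|f w| <= M) -> P.-integrable setT (EFin \o f).
Proof.
move=> mf fM; apply: (@le_integrable _ _ _ P setT measurableT _ (cst M%:E)).
- exact/measurable_EFinP.
- move=> w _ /=; rewrite lee_fin; apply: le_trans (fM w) _; exact: ler_norm.
- exact: finite_measure_integrable_cst.
Qed.

(** Steep affine functions cut off by clamp are Lipschitz approximations of the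
    indicator of a half-line. *)
Definition clamp (x : R) : R := if x <= 0 then 0 else if 1 <= x then 1 else x.

Lemma clamp_lip x y : `|clamp x - clamp y| <= `|x - y|.
Proof.
have h1 := ler_norm (x - y); have h2 := ler_norm (y - x).
rewrite distrC in h2.
rewrite /clamp ler_norml.
by case: (lerP x 0) => ?; case: (lerP 1 x) => ?; case: (lerP y 0) => ?;
  case: (lerP 1 y) => ?; apply/andP; split; lra.
Qed.

Lemma clamp_bound x : `|clamp x| <= 1.
Proof.
by rewrite /clamp; case: (lerP x 0) => ?; [rewrite normr0|case: (lerP 1 x) => ?];
  rewrite ?normr1// ger0_norm ltW.
Qed.

Variables X X' : T -> R.
Hypotheses (mX : measurable_fun setT X) (mX' : measurable_fun setT X').
Hypotheses (X0 : forall w, 0 <= X w) (X'0 : forall w, 0 <= X' w).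
Hypothesis XX' : forall j : nat,
  (\int[P]_w (expR (- (j%:R * X w)))%:E = \int[P]_w (expR (- (j%:R * X' w)))%:E)%E.

Lemma expRN_itv (Z : T -> R) w : (forall w, 0 <= Z w) -> 0 <= expR (- Z w) <= 1.
Proof. by move=> Z0; rewrite expR_ge0 -expR0 ler_expR lerNl oppr0 Z0. Qed.

Lemma measurable_expRN (Z : T -> R) : measurable_fun setT Z ->
  measurable_fun setT (fun w => expR (- Z w)).
Proof. by move=> mZ; apply: measurableT_comp => //; exact: measurable_funN. Qed.

Lemma integral_horner (Z : T -> R) (p : {poly R}) : measurable_fun setT Z ->
  (forall w, 0 <= Z w) ->
  (\int[P]_w (p.[expR (- Z w)])%:E =
   \sum_(i < size p) (p`_i)%:E * \int[P]_w (expR (- (i%:R * Z w)))%:E)%E.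
Proof.
move=> mZ Z0.
have ii (i : nat) : P.-integrable setT (fun w => (expR (- (i%:R * Z w)))%:E).
  apply: (@bounded_integrable _ 1).
    by apply: (@measurable_expRN (fun w => i%:R * Z w)); exact: measurable_funM.
  move=> w; rewrite ger0_norm ?expR_ge0//.
  by rewrite -expR0 ler_expR lerNl oppr0 mulr_ge0.
under eq_integral => w _.
  rewrite horner_coef -sumEFin.
  under eq_bigr => i _ do rewrite -expRM_natl mulrN EFinM.
  over.
rewrite /= integral_sum//; last by move=> i; exact: integrableZl.
by apply: eq_bigr => i _; rewrite integralZl.
Qed.

(** The hypothesis on the Laplace transforms at the naturals says that exp(-X)
    and exp(-X') have the same moments, hence integrate polynomials alike. *)
Lemma integral_horner_eq (p : {poly R}) :
  (\int[P]_w (p.[expR (- X w)])%:E = \int[P]_w (p.[expR (- X' w)])%:E)%E.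
Proof.
rewrite (integral_horner p mX X0) (integral_horner p mX' X'0).
by apply: eq_bigr => i _; rewrite XX'.
Qed.

Lemma measurable_horner (Z : T -> R) (p : {poly R}) : measurable_fun setT Z ->
  measurable_fun setT (fun w => p.[Z w]).
Proof.
move=> mZ; elim/poly_ind: p => [|p c IH].
  by apply: (eq_measurable_fun (cst (0 : R))) => // w _; rewrite horner0.
apply: (eq_measurable_fun (fun w => p.[Z w] * Z w + c)).
  by move=> w _; rewrite !hornerE.
by apply: measurable_funD => //; exact: measurable_funM.
Qed.

(** exp(-X) lives in the unit interval, so Bernstein polynomials carry the
    previous equality from polynomials to Lipschitz functions. *)
Lemma integral_lip_eq (phi : R -> R) (L : R) : 0 <= L ->
  (forall x, `|phi x| <= 1) ->
  (forall x y, `|phi x - phi y| <= L * `|x - y|) ->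
  (\int[P]_w (phi (expR (- X w)))%:E = \int[P]_w (phi (expR (- X' w)))%:E)%E.
Proof.
move=> L0 phi1 lip.
have H (Z : T -> R) : measurable_fun setT Z -> (forall w, 0 <= Z w) ->
    (\int[P]_w ((bernstein n.+1 (fun j => phi (j%:R / n.+1%:R))).[expR (- Z w)])%:E)%E
    @[n --> \oo] --> (\int[P]_w (phi (expR (- Z w)))%:E)%E.
  move=> mZ Z0; apply: (@bounded_convergence _ _ _ P _ _ 1).
  - move=> n; apply: measurable_horner; exact: measurable_expRN.
  - move=> n w; rewrite ler_norml; apply/andP; split.
      rewrite -(bernstein_cst n.+1 (-1) (expR (- Z w))).
      apply: bernstein_le; first exact: expRN_itv.
      by move=> j /=; move: (phi1 (j%:R / n.+1%:R)); rewrite ler_norml => /andP[].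
    rewrite -[leRHS](bernstein_cst n.+1 1 (expR (- Z w))).
    apply: bernstein_le; first exact: expRN_itv.
    by move=> j /=; move: (phi1 (j%:R / n.+1%:R)); rewrite ler_norml => /andP[].
  - by move=> w; apply: (bernstein_cvg L0 lip); exact: expRN_itv.
have cX := H X mX X0; have cX' := H X' mX' X'0.
apply: (cvg_unique _ cX); first exact: ereal_hausdorff.
apply: cvg_trans cX'; apply: near_eq_cvg; apply: nearW => n.
by rewrite integral_horner_eq.
Qed.

Lemma laplace_cdf t : P [set w | X w <= t] = P [set w | X' w <= t].
Proof.
pose c := expR (- t).
(* phi k is 1 on u >= c and tends to 0 elsewhere; u >= c means X <= t *)
pose phi (k : nat) (u : R) := clamp (1 - k%:R * (c - u)).
have H (Z : T -> R) : measurable_fun setT Z -> (forall w, 0 <= Z w) ->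
    (\int[P]_w (phi n (expR (- Z w)))%:E)%E @[n --> \oo] --> P [set w | Z w <= t].
  move=> mZ Z0.
  have mA : measurable [set w | Z w <= t].
    rewrite -[X in measurable X]setTI.
    exact: (@measurable_fun_le _ _ _ setT Z (cst t)).
  rewrite -[X in _ --> P X]setIT -integral_indic//.
  apply: (@bounded_convergence _ _ _ P _ _ 1).
  - move=> n.
    have mg : measurable_fun setT (fun w => 1 - n%:R * (c - expR (- Z w))).
      apply: measurable_funB => //; apply: measurable_funM => //.
      by apply: measurable_funB => //; exact: measurable_expRN.
    apply: measurable_fun_ifT => //; first exact: measurable_fun_ler.
    by apply: measurable_fun_ifT => //; exact: measurable_fun_ler.
  - by move=> n w; exact: clamp_bound.
  - move=> w; rewrite indicE; have [Zt|Zt] := leP (Z w) t.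
      rewrite mem_set//; apply: cvg_near_cst; apply: nearW => n.
      have h : c <= expR (- Z w) by rewrite /c ler_expR lerN2.
      have h2 : 0 <= n%:R * (expR (- Z w) - c) by rewrite mulr_ge0// subr_ge0.
      rewrite /phi /clamp ifF; last by apply/negbTE; rewrite -ltNge; lra.
      by rewrite ifT//; lra.
    rewrite memNset/=; last by apply/negP; rewrite -ltNge.
    apply: cvg_near_cst.
    have h : 0 < c - expR (- Z w) by rewrite subr_gt0 /c ltr_expR ltrN2.
    near=> n.
    have h2 : 1 <= n%:R * (c - expR (- Z w)).
      rewrite -ler_pdivrMr//; near: n; exact: nbhs_infty_ger.
    by rewrite /phi /clamp ifT//; lra.
have cX := H X mX X0; have cX' := H X' mX' X'0.
apply: (cvg_unique _ cX); first exact: ereal_hausdorff.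
apply: cvg_trans cX'; apply: near_eq_cvg; apply: nearW => n.
apply/esym/(@integral_lip_eq (phi n) n%:R) => //.
  by move=> x; exact: clamp_bound.
move=> x y; rewrite /phi; apply: le_trans (clamp_lip _ _) _.
by rewrite (_ : _ - _ = n%:R * (x - y)) ?normrM ?normr_nat//; ring.
Unshelve. all: by end_near. Qed.

End laplace_uniqueness.

(** * Term-by-term integration and entire power series *)
Section series_integral.
Context d (T : measurableType d) (R : realType).
Variables (mu : {measure set T -> \bar R}) (D : set T).

Lemma nneseries_fin_lty (c : nat -> R) : (forall n, 0 <= c n) -> cvgn (series c) ->
  (\sum_(n <oo) (c n)%:E < +oo)%E.
Proof.
move=> c0 cc.
rewrite (_ : (\sum_(n <oo) _)%E = (limn (series c))%:E) ?ltry//.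
rewrite -EFin_lim//; congr (limn _); apply/funext => n /=.
by rewrite /series/= sumEFin.
Qed.

(** The partial sums are dominated by the sum of the absolute values, which is
    integrable by monotone convergence. *)
Lemma integral_series (mD : measurable D) (f : nat -> T -> R) (g : T -> R) :
  (forall n, measurable_fun D (f n)) ->
  (\sum_(n <oo) \int[mu]_(x in D) (`|f n x|)%:E < +oo)%E ->
  (forall x, D x -> series (f ^~ x) @ \oo --> g x) ->
  mu.-integrable D (EFin \o g) /\
  series (fun n => \int[mu]_(x in D) f n x) @ \oo --> \int[mu]_(x in D) g x.
Proof.
move=> mf foo fg.
pose G x := (\sum_(n <oo) (`|f n x|)%:E)%E.
have mnf n : measurable_fun D (fun x => (`|f n x|)%:E).
  by apply/measurable_EFinP; exact: measurableT_comp.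
have nf0 n x : (0 <= (`|f n x|)%:E)%E by rewrite lee_fin.
have IG : (\int[mu]_(x in D) G x = \sum_(n <oo) \int[mu]_(x in D) (`|f n x|)%:E)%E.
  exact: integral_nneseries.
have iG : mu.-integrable D G.
  apply/integrableP; split.
    exact: ge0_emeasurable_sum.
  under eq_integral => x _ do rewrite gee0_abs ?nneseries_ge0//.
  by rewrite IG.
have ifn n : mu.-integrable D (EFin \o f n).
  apply/integrableP; split; first exact/measurable_EFinP.
  apply: le_lt_trans foo; rewrite -IG; apply: ge0_le_integral => //.
  - by apply/measurable_EFinP; exact: measurableT_comp.
  - by apply: (ge0_emeasurable_sum (P := xpredT)).
  - move=> x Dx; apply: (@le_trans _ _ (\sum_(0 <= k < n.+1) (`|f k x|)%:E)%E).
      by rewrite big_nat_recr//= leeDr// sume_ge0.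
    exact: nneseries_lim_ge.
have mF n : measurable_fun D (fun x => series (f ^~ x) n).
  exact: (@measurable_sum _ _ _ _ _ (index_iota 0 n) f mf).
have mg : measurable_fun D g by apply: (measurable_fun_cvg mF) => x Dx; exact: fg.
have leG n x : ((`|series (f ^~ x) n|)%:E <= G x)%E.
  rewrite /series/=; apply: (@le_trans _ _ (\sum_(0 <= k < n) (`|f k x|)%:E)%E).
    by rewrite sumEFin lee_fin ler_norm_sum.
  exact: nneseries_lim_ge.
have [] := @dominated_convergence _ T R mu D mD (fun n x => (series (f ^~ x) n)%:E) (EFin \o g) G.
- by move=> n; apply/measurable_EFinP.
- exact/measurable_EFinP.
- by apply: aeW => x Dx; apply: cvg_EFin; [exact: nearW|exact: fg].
- exact: iG.
- by apply: aeW => x n _; exact: leG.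
move=> ig _ cv; split => //.
have E n : (\int[mu]_(x in D) (series (f ^~ x) n)%:E)%E =
    (series (fun n => \int[mu]_(x in D) f n x) n)%:E.
  rewrite /series/= -sumEFin.
  under eq_integral do rewrite -sumEFin.
  rewrite integral_sum//; apply: eq_bigr => k _.
  by rewrite /Rintegral fineK//; apply: integrable_fin_num => //; exact: ifn.
move: cv; rewrite (_ : (fun n => _) = EFin \o series (fun n => \int[mu]_(x in D) f n x)); last first.
  by apply/funext => n /=; rewrite E.
by rewrite -(fineK (integrable_fin_num mD ig)) => /fine_cvgP[_].
Qed.

End series_integral.

Section entire.
Context {R : realType}.

(** Infinite radius of convergence, stated as a bound on the terms since this
    form passes at once to the coefficients of the derivative. *)
Definition entire (c : nat -> R) :=
  forall y : R, 0 <= y -> exists M, forall m, `|c m| * y ^+ m <= M.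

Lemma geometric_bound_cvg (u : nat -> R) (M : R) :
  (forall m, 0 <= u m) -> (forall m, u m * 2 ^+ m <= M) -> cvgn (series u).
Proof.
move=> u0 uM.
apply: (@series_le_cvg _ _ (geometric M 2^-1)) => //.
- by move=> m /=; rewrite mulr_ge0 ?exprn_ge0// (le_trans _ (uM 0%N))// mulr_ge0.
- by move=> m /=; rewrite exprVn ler_pdivlMr ?exprn_gt0.
- by apply: is_cvg_geometric_series; rewrite ger0_norm// invf_lt1// ltr1n.
Qed.

Lemma entire_cvg_norm (c : nat -> R) (x : R) : entire c ->
  cvgn (series (fun m => `|c m * x ^+ m|)).
Proof.
move=> ec.
have [M hM] := ec (2 * `|x|) (mulr_ge0 (ler0n _ _) (normr_ge0 _)).
apply: (@geometric_bound_cvg _ M) => // m.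
by rewrite normrM normrX -mulrA -exprMn [X in _ * X ^+ _]mulrC.
Qed.

Lemma entire_cvg (c : nat -> R) (x : R) : entire c -> cvgn (pseries c x).
Proof. by move=> ec; apply: normed_cvg; exact: entire_cvg_norm. Qed.

Lemma natr_le_expr2 m : m.+1%:R <= 2 ^+ m.+1 :> R.
Proof. by rewrite -natrX ler_nat ltnW// ltn_expl. Qed.

Lemma entire_diffs (c : nat -> R) : entire c -> entire (pseries_diffs c).
Proof.
move=> ec y y0.
(* the factor 2 ^ m.+1 absorbs the factor m.+1 of the derivative *)
have y2 : 0 <= 2 * (y + 1) by rewrite mulr_ge0// addr_ge0.
have [M hM] := ec _ y2; exists M => m; apply: le_trans (hM m.+1).
rewrite /pseries_diffs normrM normr_nat mulrAC mulrC ler_wpM2l//.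
rewrite exprMn; apply: ler_pM => //; first by rewrite exprn_ge0.
  exact: natr_le_expr2.
apply: (@le_trans _ _ ((y + 1) ^+ m)); first by rewrite lerXn2r ?nnegrE ?addr_ge0// lerDl.
by rewrite exprS ler_peMl ?exprn_ge0 ?addr_ge0// lerDr.
Qed.

Lemma entire_derive (c : nat -> R) (x : R) : entire c ->
  is_derive x 1 (fun x => limn (pseries c x)) (limn (pseries (pseries_diffs c) x)).
Proof.
move=> ec; apply: (@pseries_snd_diffs _ c (`|x| + 1)).
- exact: entire_cvg.
- by apply: entire_cvg; exact: entire_diffs.
- by apply: entire_cvg; do 2 apply: entire_diffs.
- by rewrite [ltRHS]ger0_norm ?addr_ge0// ltrDl.
Qed.

(** The Mittag-Leffler coefficients: apply the lower bound on Gamma with B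
    chosen so that B^alpha exceeds C y, which makes the terms bounded. *)
Lemma Gamma_entire (alpha C K : R) (a : nat -> R) : 0 < alpha -> 0 <= C ->
  (forall m, `|a m| <= K * C ^+ m) ->
  entire (fun m => a m / Gamma (alpha * m%:R + 1)).
Proof.
move=> alpha0 C0 aC y y0.
have Cy : 0 <= C * y by rewrite mulr_ge0.
(* B ^ alpha = C y + 1 *)
pose B := (C * y + 1) `^ alpha^-1.
have B0 : 0 < B by rewrite powR_gt0// ltr_wpDl.
exists (K * expR B) => m.
have K0 : 0 <= K by rewrite -[K]mulr1 -(expr0 C) (le_trans _ (aC 0%N)).
have g0 : 0 < Gamma (alpha * m%:R + 1).
  by rewrite Gamma_gt0// ltr_wpDl// mulr_ge0// ltW.
rewrite normrM normfV (gtr0_norm g0) mulrAC ler_pdivrMr//.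
apply: (@le_trans _ _ (K * (C * y + 1) ^+ m)).
  apply: (@le_trans _ _ (K * (C * y) ^+ m)).
    by rewrite exprMn mulrA ler_wpM2r ?exprn_ge0.
  by rewrite ler_wpM2l// lerXn2r ?nnegrE ?addr_ge0// lerDl.
rewrite -mulrA ler_wpM2l//.
have := @Gamma_ge _ (alpha * m%:R) B _ B0.
rewrite -powRrM mulrA mulVf ?gt_eqF// mul1r powR_mulrn ?addr_ge0//.
rewrite expRN ler_pdivrMr ?expR_gt0// [Gamma _ * _]mulrC; apply.
by rewrite mulr_ge0// ltW.
Qed.

End entire.

(** * The Caputo derivative of a Mittag-Leffler series *)
Section fractional_derivative.
Context {R : realType}.
Local Notation mu := (@lebesgue_measure R).
Variables (alpha C K : R) (a : nat -> R) (p : R -> R).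
Hypotheses (alpha01 : 0 < alpha <= 1) (C0 : 0 <= C).
Hypothesis aC : forall m, `|a m| <= K * C ^+ m.

Let c m := a m / Gamma (alpha * m%:R + 1).
Let c1 m := a m.+1 / Gamma (alpha * m%:R + 1).
Hypothesis pE : forall t : R, 0 < t -> p t = limn (pseries c (t `^ alpha)).

Let alpha0 : 0 < alpha. Proof. by have /andP[] := alpha01. Qed.
Let ec : entire c. Proof. exact: (Gamma_entire alpha0 C0 aC). Qed.

Let ec1 : entire c1.
Proof.
apply: (@Gamma_entire R alpha C (K * C) (fun m => a m.+1)) => // m.
by rewrite -mulrA -exprS.
Qed.

Let b_gt0 m : 0 < alpha * m.+1%:R.
Proof. by rewrite mulr_gt0. Qed.

Let c_succ m : m.+1%:R * c m.+1 * alpha = a m.+1 / Gamma (alpha * m.+1%:R).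
Proof.
rewrite /c GammaS//; field.
by rewrite nat1r !gt_eqF// Gamma_gt0.
Qed.

Let p_derive (s : R) : 0 < s ->
  is_derive s 1 p (limn (pseries (pseries_diffs c) (s `^ alpha)) * (alpha * s `^ (alpha - 1))).
Proof.
move=> s0.
have D1 := is_derive1_powR alpha s0.
have D2 := @is_derive1_comp _ (fun x => limn (pseries c x)) (@powR R ^~ alpha) s _ _
  (entire_derive _ ec) D1.
apply: near_eq_is_derive D2 => //.
near=> t; rewrite pE//; near: t; exact: lt_nbhsr.
Unshelve. all: by end_near. Qed.

Let c1_cvg (x : R) : cvgn (pseries c1 x).
Proof. exact: entire_cvg. Qed.

Lemma derive_series (t : R) : 0 < t -> alpha = 1 ->
  is_derive t 1 p (limn (pseries c1 (t `^ alpha))).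
Proof.
move=> t0 alpha1; apply: is_derive_eq (p_derive t0) _.
have -> : alpha * t `^ (alpha - 1) = 1 by rewrite alpha1 subrr powRr0 mulr1.
rewrite mulr1; congr (limn (pseries _ _)).
apply/funext => m; rewrite /pseries_diffs -[LHS]mulr1 -[X in _ * X]alpha1 c_succ /c1.
by rewrite alpha1 !mul1r -natr1.
Qed.

(** The m-th term of the Caputo integrand at s. *)
Let f (t : R) m (s : R) := a m.+1 / Gamma (alpha * m.+1%:R) *
  ((t - s) `^ (1 - alpha - 1) * s `^ (alpha * m.+1%:R - 1)).

Let integral_f (K' t : R) m : 0 < t -> alpha < 1 ->
  (\int[mu]_(s in `]0%R, t[) (K' / Gamma (alpha * m.+1%:R) *
     ((t - s) `^ (1 - alpha - 1) * s `^ (alpha * m.+1%:R - 1)))%:E =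
  (Gamma (1 - alpha) * (K' / Gamma (alpha * m%:R + 1) * (t `^ alpha) ^+ m))%:E)%E.
Proof.
move=> t0 alpha1.
under eq_integral do rewrite EFinM.
rewrite integralZl//; last first.
  apply/integrableP; split.
    apply/measurable_EFinP; apply: measurable_funM.
      apply: (measurableT_comp (measurable_powR _)).
      exact: measurable_funB.
    by apply: measurable_funTS; exact: measurable_powR.
  under eq_integral do rewrite gee0_abs ?lee_fin ?mulr_ge0 ?powR_ge0//.
  by rewrite beta_integral ?subr_gt0// ltry.
rewrite beta_integral ?subr_gt0// -EFinM; congr (_%:E).
have -> : 1 - alpha + alpha * m.+1%:R = alpha * m%:R + 1 by rewrite -natr1; ring.
rewrite addrK -powR_mulrn ?powR_ge0// -powRrM.
field; rewrite !gt_eqF// ?Gamma_gt0// ltr_wpDl// mulr_ge0// ltW//.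
Qed.

(** Term by term, the Caputo derivative multiplies by a Beta integral that turns
    the Gamma factor of index m + 1 into the one of index m: it shifts the
    sequence a by one. *)
Lemma caputo_series (t : R) : 0 < t ->
  ex_caputo alpha p t /\ caputo alpha p t = limn (pseries c1 (t `^ alpha)).
Proof.
move=> t0; rewrite /ex_caputo /caputo; case: ifPn => [/eqP alpha1|alphaN1].
  have D := derive_series t0 alpha1.
  by split; [exact: ex_derive|rewrite derive1E derive_val].
have alpha1 : alpha < 1 by have /andP[_] := alpha01; rewrite le_eqVlt (negbTE alphaN1).
have G0 : 0 < Gamma (1 - alpha) by rewrite Gamma_gt0// subr_gt0.
have mf m : measurable_fun `]0, t[ (f t m).
  apply: measurable_funM => //; apply: measurable_funM.
    by apply: (measurableT_comp (measurable_powR _)); exact: measurable_funB.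
  by apply: measurable_funTS; exact: measurable_powR.
have intf m : \int[mu]_(s in `]0, t[) f t m s = Gamma (1 - alpha) * (c1 m * (t `^ alpha) ^+ m).
  by rewrite /Rintegral integral_f.
have [] := @integral_series _ _ _ mu `]0, t[%classic _ (f t) (caputo_integrand alpha p t) mf.
- exact: measurable_itv.
- have -> : (\sum_(n <oo) \int[mu]_(x in `]0%R, t[) (`|f t n x|)%:E =
      \sum_(n <oo) (Gamma (1 - alpha) * `|c1 n * (t `^ alpha) ^+ n|)%:E)%E.
    apply: eq_eseriesr => n _.
    have g0 : 0 < Gamma (alpha * n%:R + 1) by rewrite Gamma_gt0// ltr_wpDl// mulr_ge0// ltW.
    rewrite normrM /c1 normrM normfV (gtr0_norm g0) (@ger0_norm _ (_ ^+ n)) ?exprn_ge0 ?powR_ge0//.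
    rewrite -integral_f//; apply: eq_integral => s _; congr (_%:E).
    rewrite /f normrM [X in _ * X]ger0_norm ?mulr_ge0 ?powR_ge0//.
    by rewrite normrM normfV (gtr0_norm (Gamma_gt0 _)).
  apply: nneseries_fin_lty; first by move=> n; rewrite mulr_ge0// ltW.
  rewrite (_ : series _ = (fun n =>
      Gamma (1 - alpha) * series (fun m => `|c1 m * (t `^ alpha) ^+ m|) n)).
    by apply: is_cvgM; [exact: is_cvg_cst|exact: entire_cvg_norm].
  by apply/funext => n; rewrite /series/= mulr_sumr.
- move=> s /=; rewrite in_itv/= => /andP[s0 st].
  rewrite /caputo_integrand derive1E; have [_ ->] := p_derive s0.
  rewrite mulrC -mulrA.
  rewrite (_ : series _ = (fun n => pseries (pseries_diffs c) (s `^ alpha) n *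
     (alpha * s `^ (alpha - 1) * (t - s) `^ (- alpha)))).
    apply: cvgM; last exact: cvg_cst.
    by apply: entire_cvg; exact: entire_diffs.
  apply/funext => n; rewrite /pseries /series/= mulr_suml; apply: eq_bigr => m _.
  rewrite /f -c_succ /pseries_diffs.
  have -> : 1 - alpha - 1 = - alpha by ring.
  have -> : s `^ (alpha * m.+1%:R - 1) = s `^ (alpha - 1) * (s `^ alpha) ^+ m.
    rewrite -powR_mulrn ?powR_ge0// -powRrM -powRD; last by rewrite (gt_eqF s0) implybT.
    by congr powR; rewrite -natr1; ring.
  by ring.
move=> ig cv; split.
  split => // s /andP[s0 _].
  by have [] := p_derive s0.
have cv2 : series (fun n => \int[mu]_(x in `]0, t[) f t n x) @ \oo -->
    Gamma (1 - alpha) * limn (pseries c1 (t `^ alpha)).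
  rewrite (_ : series _ = (fun n => Gamma (1 - alpha) * pseries c1 (t `^ alpha) n)).
    by apply: cvgM; [exact: cvg_cst|exact: c1_cvg].
  by apply/funext => n; rewrite /pseries /series/= mulr_sumr; apply: eq_bigr => m _; rewrite intf.
have -> : \int[mu]_(s in `]0, t[) caputo_integrand alpha p t s =
    Gamma (1 - alpha) * limn (pseries c1 (t `^ alpha)).
  by apply: (cvg_unique _ cv cv2).
by rewrite mulrA mulVf ?mul1r// gt_eqF.
Qed.

End fractional_derivative.

(** * The inverse stable subordinator *)
Section tails.
Context d (T : measurableType d) (R : realType) (P : probability T R).

Lemma ge0_integral_tail (X : T -> R) : measurable_fun setT X -> (forall w, 0 <= X w) ->
  (\int[P]_w (X w)%:E = \int[lebesgue_measure]_(r in `[0%R, +oo[) P [set w | (r < X w)%R])%E.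
Proof.
move=> mX X0.
pose X' : {RV P >-> R} := HB.pack X (isMeasurableFun.Build _ _ _ _ X mX).
transitivity ('E_P[X'])%E; first by rewrite expectation_def.
rewrite ge0_expectation_ccdf//; apply: eq_integral => r _.
rewrite /ccdf/= /distribution /pushforward; congr (P _).
by apply/seteqP; split => w /=; rewrite in_itv/= andbT.
Qed.

Lemma measurable_gt_set (X : T -> R) r : measurable_fun setT X ->
  measurable [set w | r < X w].
Proof.
move=> mX; rewrite (_ : [set w | _] = ~` [set w | X w <= r]); last first.
  by apply/seteqP; split => w /=; rewrite ltNge => /negP.
apply: measurableC; rewrite -[X in measurable X]setTI.
exact: (@measurable_fun_le _ _ _ setT X (cst r)).
Qed.

Lemma measurable_ge_set (X : T -> R) r : measurable_fun setT X ->
  measurable [set w | r <= X w].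
Proof.
move=> mX; rewrite -[X in measurable X]setTI.
exact: (@measurable_fun_le _ _ _ setT (cst r) X).
Qed.

Lemma cvg_tail_ge (X : T -> R) r : measurable_fun setT X ->
  P [set w | r + n.+1%:R^-1 <= X w] @[n --> \oo] --> P [set w | r < X w].
Proof.
move=> mX.
have -> : [set w | r < X w] = \bigcup_n [set w | r + n.+1%:R^-1 <= X w].
  apply/seteqP; split => w /=; last first.
    by move=> [n _] /=; apply: lt_le_trans; rewrite ltrDl invr_gt0.
  rewrite -subr_gt0 => h.
  have /cvgr_lt/(_ _ h)[N _ /(_ N (leqnn _)) /= hN] := @cvg_harmonic R.
  by exists N => //=; rewrite addrC -lerBrDr ltW.
apply: nondecreasing_cvg_mu.
- by move=> n; exact: measurable_ge_set.
- by apply: bigcup_measurable => n _; exact: measurable_ge_set.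
- move=> m n mn; apply/subsetPset => w /=; apply: le_trans.
  by rewrite lerD2l lef_pV2 ?posrE// ler_nat.
Qed.

(** The comparisons between D and its inverse lose strictness, since they
    relate strict tails to large ones; right-continuity of the tail recovers
    it. *)
Lemma tail_gt_le (X Y : T -> R) r : measurable_fun setT X -> measurable_fun setT Y ->
  (forall s, r < s -> (P [set w | (s < X w)%R] <= P [set w | (s <= Y w)%R])%E) ->
  (P [set w | (r < X w)%R] <= P [set w | (r < Y w)%R])%E.
Proof.
move=> mX mY H.
have cX := @cvg_tail_ge X r mX.
pose s n : R := r + n.+2%:R^-1.
have rs n : r < s n < r + n.+1%:R^-1.
  by rewrite ltrDl invr_gt0 ltr0n/= ltrD2l ltf_pV2 ?posrE// ltr_nat.
have le1 n : (P [set w | (r + n.+1%:R^-1 <= X w)%R] <= P [set w | (r < Y w)%R])%E.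
  have /andP[h1 h2] := rs n.
  apply: (@le_trans _ _ (P [set w | s n < X w])).
    apply: le_measure; rewrite ?inE; [exact: measurable_ge_set|exact: measurable_gt_set|].
    by move=> w /=; apply: lt_le_trans.
  apply: le_trans (H _ h1) _.
  apply: le_measure; rewrite ?inE; [exact: measurable_ge_set|exact: measurable_gt_set|].
  by move=> w /=; apply: lt_le_trans.
move/cvg_lim : cX => <-//.
by apply: lime_le; [apply/cvg_ex; eexists; exact: cvg_tail_ge|exact: nearW].
Qed.

(** By the tail formula for the expectation of a nonnegative variable. *)
Lemma eq_tail_moment (X Y : T -> R) (m : nat) :
  measurable_fun setT X -> measurable_fun setT Y ->
  (forall w, 0 <= X w) -> (forall w, 0 <= Y w) ->
  (forall r, 0 <= r -> P [set w | r < X w] = P [set w | r < Y w]) ->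
  (\int[P]_w (X w ^+ m.+1)%:E = \int[P]_w (Y w ^+ m.+1)%:E)%E.
Proof.
move=> mX mY X0 Y0 XY.
have mpow (Z : T -> R) : measurable_fun setT Z -> measurable_fun setT (fun w => Z w ^+ m.+1).
  by move=> mZ; exact: measurable_funX.
rewrite !ge0_integral_tail ?exprn_ge0//; last 4 first.
- exact: mpow.
- by move=> w; rewrite exprn_ge0.
- exact: mpow.
- by move=> w; rewrite exprn_ge0.
apply: eq_integral => r; rewrite inE/= in_itv/= andbT => r0.
have rE : r = (r `^ (m.+1%:R^-1)) ^+ m.+1.
  by rewrite -powR_mulrn ?powR_ge0// -powRrM mulVf ?pnatr_eq0// powRr1.
have E (Z : T -> R) : (forall w, 0 <= Z w) ->
    [set w | r < Z w ^+ m.+1] = [set w | r `^ (m.+1%:R^-1) < Z w].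
  move=> Z0; apply/seteqP; split => w /=.
    by rewrite {1}rE ltr_pXn2r ?nnegrE ?powR_ge0.
  by rewrite {2}rE ltr_pXn2r ?nnegrE ?powR_ge0.
by rewrite !E// XY// powR_ge0.
Qed.

End tails.

Section subordinator.
Context d (T : measurableType d) (R : realType) (P : probability T R).
Variables (alpha : R) (D : R -> T -> R).
Hypotheses (alpha0 : 0 < alpha) (hD : stable_subordinator P alpha D).
Local Notation Y := (inverse_subordinator D).

Lemma subordinator_ge0 (t : R) w : 0 <= t -> 0 <= D t w.
Proof. by move=> t0; rewrite -(stable_start hD w) (stable_nondecreasing hD). Qed.

Lemma inverse_ge0 t w : 0 <= Y t w.
Proof.
rewrite /inverse_subordinator.
have [->|/set0P ne] := eqVneq [set r | 0 <= r /\ t < D r w] set0; first by rewrite inf0.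
by apply: lb_le_inf => // r [].
Qed.

Lemma subordinator_le_inverse (r t : R) w : 0 <= r -> r < Y t w -> D r w <= t.
Proof.
move=> r0; apply: contraTT; rewrite -ltNge -leNgt => h.
by apply: ge_inf => //=; exists 0 => x [].
Qed.

Lemma inverse_ge (r t : R) w : 0 <= r -> D r w <= t -> (exists2 r', 0 <= r' & t < D r' w) ->
  r <= Y t w.
Proof.
move=> r0 Drt [r' r'0 h]; apply: lb_le_inf; first by exists r'.
move=> x /= [x0 tx]; rewrite leNgt; apply/negP => xr.
have := stable_nondecreasing hD w x0 (ltW xr).
by rewrite leNgt (le_lt_trans Drt tx).
Qed.

(** As D is monotone, an event on the infimum is a countable combination of
    events on D; the second part of the union collects the paths that stay
    below t, for which the infimum of the empty set is 0. *)
Lemma inverse_measurable t : 0 <= t -> measurable_fun setT (Y t).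
Proof.
move=> t0.
apply: (measurability _ (RGenInftyO.measurableE R)).
move=> _ [_ [r ->] <-]; rewrite setTI.
have [r0|r0] := leP r 0.
  rewrite (_ : _ @^-1` _ = set0)//; apply/seteqP; split => w //=.
  by rewrite in_itv/= ltNge (le_trans r0)// inverse_ge0.
rewrite (_ : _ @^-1` _ = (\bigcup_n [set w | t < D (Num.max 0 (r - n.+1%:R^-1)) w]) `|`
    (\bigcap_n [set w | D n%:R w <= t])); last first.
  apply/seteqP; split => w /=.
    rewrite in_itv/= => Yr.
    have [[x [x0 xD]]|] := pselect (exists x, 0 <= x /\ t < D x w); last first.
      move=> /forallNP h; right => n _ /=.
      by rewrite leNgt; apply/negP => ?; apply: (h n%:R).
    have /inf_lt/(_ Yr)[y [y0 yD] yr] : [set r | 0 <= r /\ t < D r w] !=set0 by exists x.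
    left; move: (yr); rewrite -subr_gt0 => h.
    have /cvgr_lt/(_ _ h)[N _ /(_ N (leqnn _)) /= hN] := @cvg_harmonic R.
    exists N => //=; apply: lt_le_trans yD _; apply: (stable_nondecreasing hD) => //.
    by rewrite le_max; apply/orP; right; rewrite lerBrDr addrC -lerBrDr ltW.
  rewrite in_itv/= => -[[n _ /= h]|h].
    apply: (@le_lt_trans _ _ (Num.max 0 (r - n.+1%:R^-1))).
      apply: ge_inf; first by exists 0 => x [].
      by split => //; rewrite le_max lexx.
    by rewrite gt_max r0/= gtrDl oppr_lt0 invr_gt0.
  rewrite /inverse_subordinator (_ : [set r | _] = set0) ?inf0//.
  apply/seteqP; split => x //= [x0 tx].
  have := h (Num.truncn x).+1 I => /=; rewrite leNgt => /negP; apply.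
  apply: lt_le_trans tx _; apply: (stable_nondecreasing hD) => //.
  by rewrite ltW// truncnS_gt.
apply: measurableU.
  apply: bigcup_measurable => n _; apply: measurable_gt_set.
  by apply: (stable_measurable hD); rewrite le_max lexx.
apply: bigcap_measurable => // n _.
rewrite -[X in measurable X]setTI.
by apply: (@measurable_fun_le _ _ _ setT _ (cst t)) => //; exact: (stable_measurable hD).
Qed.

Lemma subordinator_laplace (s t : R) : 0 < s -> 0 <= t ->
  (\int[P]_w (expR (- (s * D t w)))%:E = (expR (- (t * s `^ alpha)))%:E)%E.
Proof.
move=> s0 t0; have := stable_laplace hD s0 t0; rewrite mulNr => <-.
by rewrite unlock; apply: eq_integral => w _; rewrite mulNr.
Qed.

Lemma measurable_le_subordinator (r t : R) : 0 <= r -> measurable [set w | D r w <= t].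
Proof.
move=> r0; rewrite -[X in measurable X]setTI.
by apply: (@measurable_fun_le _ _ _ setT _ (cst t)) => //; exact: (stable_measurable hD).
Qed.

(** The Chernoff bound.  With r going to infinity it shows that D is almost
    surely unbounded, with s going to infinity that D 1 is almost surely
    positive. *)
Lemma subordinator_chernoff (s r t : R) : 0 < s -> 0 <= r ->
  (P [set w | (D r w <= t)%R] <= (expR (s * t) * expR (- (r * s `^ alpha)))%:E)%E.
Proof.
move=> s0 r0.
have mA := measurable_le_subordinator t r0.
rewrite EFinM -subordinator_laplace// -ge0_integralZl//; last first.
  apply/measurable_EFinP; apply: (@measurable_expRN _ _ _ (fun w => s * D r w)).
  by apply: measurable_funM => //; exact: (stable_measurable hD).
rewrite -[X in P X]setIT -integral_indic//.
apply: ge0_le_integral => //.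
- by apply/measurable_EFinP.
- apply: measurable_funeM; apply/measurable_EFinP.
  apply: (@measurable_expRN _ _ _ (fun w => s * D r w)).
  by apply: measurable_funM => //; exact: (stable_measurable hD).
- move=> w _; rewrite -EFinM lee_fin indicE -expRD -mulrBr.
  have [wA|_] := boolP (w \in _); last by rewrite expR_ge0.
  rewrite inE/= in wA.
  by rewrite -expR0 ler_expR mulr_ge0 ?subr_ge0// ltW.
Qed.

Lemma subordinator_bounded_null (t : R) : P (\bigcap_n [set w | D n%:R w <= t]) = 0%E.
Proof.
have mA : measurable (\bigcap_n [set w | D n%:R w <= t]).
  by apply: bigcap_measurable => // n _; exact: measurable_le_subordinator.
apply/eqP; rewrite eq_le measure_ge0 andbT.
have H (n : nat) : (P (\bigcap_n [set w | (D n%:R w <= t)%R]) <= (expR t * expR (- n%:R))%:E)%E.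
  apply: (@le_trans _ _ (P [set w | D n%:R w <= t])).
    apply: le_measure; rewrite ?inE//; first exact: measurable_le_subordinator.
    by move=> w; apply.
  apply: le_trans (@subordinator_chernoff 1 n%:R t ltr01 _) _ => //.
  by rewrite powR1 mulr1 mul1r.
have c : (expR t * expR (- n%:R))%:E @[n --> \oo] --> (0 : \bar R).
  apply: cvg_EFin; first exact: nearW.
  rewrite -(mulr0 (expR t)); apply: cvgM; first exact: cvg_cst.
  apply: (@cvg_comp _ _ _ (fun n : nat => n%:R : R) (fun x : R => expR (- x)) _ (pinfty_nbhs R)).
    exact: cvgr_idn.
  exact: cvgr_expR.
rewrite -(cvg_lim _ c)//; apply: lime_ge; first by apply/cvg_ex; exists 0%E.
exact: nearW.
Qed.

Lemma subordinator_gt0_null : P [set w | D 1 w <= 0] = 0%E.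
Proof.
apply/eqP; rewrite eq_le measure_ge0 andbT.
have c : (expR (- (n.+1%:R `^ alpha)))%:E @[n --> \oo] --> (0 : \bar R).
  apply: cvg_EFin; first exact: nearW.
  apply: (@cvg_comp _ _ _ (fun n : nat => n.+1%:R : R)
    (fun x : R => expR (- (x `^ alpha))) _ (pinfty_nbhs R)).
    by rewrite (cvg_shiftS (fun n => n%:R : R)); exact: cvgr_idn.
  apply: (@cvg_comp _ _ _ (@powR R ^~ alpha) (fun x : R => expR (- x)) _ (pinfty_nbhs R)).
    exact: powR_cvgy.
  exact: cvgr_expR.
rewrite -(cvg_lim _ c)//; apply: lime_ge; first by apply/cvg_ex; exists 0%E.
apply: nearW => n.
apply: le_trans (@subordinator_chernoff n.+1%:R 1 0 _ _) _ => //.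
by rewrite mulr0 expR0 !mul1r.
Qed.

(** Self-similarity: both variables have Laplace transform exp(-r s^alpha). *)
Lemma subordinator_scaling (r t : R) : 0 < r ->
  P [set w | D r w <= t] = P [set w | r `^ alpha^-1 * D 1 w <= t].
Proof.
move=> r0; apply: laplace_cdf.
- by apply: (stable_measurable hD); exact: ltW.
- by apply: measurable_funM => //; exact: (stable_measurable hD).
- by move=> w; apply: subordinator_ge0; exact: ltW.
- by move=> w; rewrite mulr_ge0 ?powR_ge0// subordinator_ge0.
move=> [|j].
  by under eq_integral do rewrite mul0r; under [RHS]eq_integral do rewrite mul0r.
rewrite subordinator_laplace ?(ltW r0)//.
under [RHS]eq_integral do rewrite mulrA.
rewrite subordinator_laplace ?mulr_gt0 ?powR_gt0//.
rewrite powRM ?powR_ge0// -powRrM mulVf ?gt_eqF// powRr1 ?ltW//.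
by rewrite mul1r mulrC.
Qed.

(** The variable (t / D 1)^alpha.  Where D 1 vanishes, on a null set, its value
    is 0 as alpha is not 0. *)
Definition scaled_law (t : R) (w : T) : R := t `^ alpha * D 1 w `^ (- alpha).

Lemma scaled_law_measurable t : measurable_fun setT (scaled_law t).
Proof.
apply: measurable_funM => //; apply: (measurableT_comp (measurable_powR _)).
exact: (stable_measurable hD).
Qed.

Lemma scaled_law_ge0 t w : 0 <= scaled_law t w.
Proof. by rewrite mulr_ge0 ?powR_ge0. Qed.

Lemma le_measure_null (A B N : set T) : measurable A -> measurable B ->
  measurable N -> P N = 0%E -> A `<=` B `|` N -> (P A <= P B)%E.
Proof.
move=> mA mB mN N0 ABN.
apply: (@le_trans _ _ (P (B `|` N))).
  by apply: le_measure; rewrite ?inE//; exact: measurableU.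
by apply: le_trans (measureU2 _ mB mN) _; rewrite /= N0 adde0.
Qed.

(** Up to null sets, Y t > r, D r <= t, r^(1/alpha) D 1 <= t and
    (t / D 1)^alpha >= r describe the same event, with scaling in law used in
    the middle. *)
Lemma inverse_tail (t r : R) : 0 <= t -> 0 <= r ->
  P [set w | r < Y t w] = P [set w | r < scaled_law t w].
Proof.
move=> t0 r0.
have mY := inverse_measurable t0; have mW := scaled_law_measurable t.
have mS s : measurable [set w | s `^ alpha^-1 * D 1 w <= t].
  rewrite -[X in measurable X]setTI.
  apply: (@measurable_fun_le _ _ _ setT _ (cst t)) => //.
  by apply: measurable_funM => //; exact: (stable_measurable hD).
have sK s : 0 <= s -> (s `^ alpha^-1) `^ alpha = s.
  by move=> s0; rewrite -powRrM mulVf ?gt_eqF// powRr1.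
have a0 : 0 <= alpha by exact: ltW.
apply/eqP; rewrite eq_le; apply/andP; split; apply: tail_gt_le => // s rs.
- have s0 : 0 < s by exact: le_lt_trans rs.
  apply: (@le_trans _ _ (P [set w | D s w <= t])).
    apply: le_measure; rewrite ?inE; [exact: measurable_gt_set| |].
      by apply: measurable_le_subordinator; exact: ltW.
    by move=> w /=; apply: subordinator_le_inverse; exact: ltW.
  rewrite subordinator_scaling//.
  apply: (le_measure_null _ _ _ subordinator_gt0_null) => //.
  - exact: measurable_ge_set.
  - exact: measurable_le_subordinator.
  - move=> w /= h; have [D0|D0] := leP (D 1 w) 0; [by right|left].
    rewrite /scaled_law powRN ler_pdivlMr ?powR_gt0//.
    have /(ge0_ler_powR a0) : s `^ alpha^-1 * D 1 w <= t by [].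
    rewrite powRM ?powR_ge0 ?(ltW D0)// sK ?(ltW s0)//.
    by apply; rewrite ?nnegrE ?mulr_ge0 ?powR_ge0// ltW.
- have s0 : 0 < s by exact: le_lt_trans rs.
  apply: (@le_trans _ _ (P [set w | D s w <= t])).
    rewrite subordinator_scaling//.
    apply: le_measure; rewrite ?inE//; [exact: measurable_gt_set|].
    move=> w /=; rewrite /scaled_law powRN => h.
    have D0 : 0 < D 1 w.
      rewrite lt_neqAle subordinator_ge0// andbT; apply/eqP => D0; move: h.
      by rewrite -D0 powR0 ?gt_eqF// invr0 mulr0 ltNge (ltW s0).
    move: h; rewrite ltr_pdivlMr ?powR_gt0// => h.
    rewrite leNgt; apply/negP => h2; move: h; rewrite ltNge => /negP; apply.
    have /(ge0_ler_powR a0) := ltW h2.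
    rewrite powRM ?powR_ge0 ?(ltW D0)// sK ?(ltW s0)//.
    by apply; rewrite ?nnegrE ?mulr_ge0 ?powR_ge0// ltW.
  apply: (le_measure_null _ _ _ (subordinator_bounded_null t)) => //.
  - by apply: measurable_le_subordinator; exact: ltW.
  - exact: measurable_ge_set.
  - by apply: bigcap_measurable => // n _; exact: measurable_le_subordinator.
  - move=> w /= h.
    have [[r' r'0 hr']|/forall2NP hn] := pselect (exists2 r', 0 <= r' & t < D r' w).
      by left; apply: inverse_ge => //; [exact: ltW|exists r'].
    right => n _ /=; have [//|] := hn n%:R.
    by move=> /negP; rewrite -leNgt.
Qed.

(** Integrating s^(b - 1) exp(-s D 1) over s first gives Gamma(b) (D 1)^(-b);
    integrating over the probability space first gives s^(b - 1) exp(-s^alpha),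
    whose integral is known when b is a multiple of alpha. *)
Lemma negative_moment (m : nat) :
  (\int[P]_w (D 1 w `^ (- (alpha * m.+1%:R)))%:E =
   (m`!%:R / alpha / Gamma (alpha * m.+1%:R))%:E)%E.
Proof.
set b := alpha * m.+1%:R.
have b0 : 0 < b by rewrite mulr_gt0.
have G0 := Gamma_gt0 b0.
pose g (s x : R) : R := if 0 < s then s `^ (b - 1) * expR (- (s * x)) else 0.
have g0 s x : 0 <= g s x.
  by rewrite /g; case: ifP => // _; rewrite mulr_ge0 ?powR_ge0 ?expR_ge0.
have mD1 : measurable_fun setT (D 1) by exact: (stable_measurable hD).
have mg : measurable_fun setT (fun z : T * R => g z.2 (D 1 z.1)).
  apply: measurable_fun_ifT => //; first exact: measurable_fun_ltr.
  apply: measurable_funM; first by apply: (measurableT_comp (measurable_powR _)).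
  apply: measurableT_comp => //; apply: measurable_funN; apply: measurable_funM => //.
  exact: measurableT_comp.
have gE (f : R -> R) : (\int[lebesgue_measure]_s (if 0 < s then f s else 0)%:E =
    \int[lebesgue_measure]_(s in `]0%R, +oo[) (f s)%:E)%E.
  rewrite [RHS]integral_mkcond; apply: eq_integral => x _.
  rewrite patchE; case: ifPn => [x0|]; first by rewrite mem_set//= in_itv/= x0.
  by move=> x0; rewrite memNset//= in_itv/= andbT; exact/negP.
have H : (\int[P]_w (\int[lebesgue_measure]_s (g s (D 1 w))%:E) =
    \int[P]_w (D 1 w `^ (- b) * Gamma b)%:E)%E.
  apply: ae_eq_integral => //.
  - apply: (@measurable_fun_fubini_tonelli_F _ _ _ _ _ lebesgue_measure
      (fun z => (g z.2 (D 1 z.1))%:E)).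
      exact/measurable_EFinP.
    by move=> z; rewrite lee_fin.
  - apply/measurable_EFinP; apply: measurable_funM => //.
    exact: (measurableT_comp (measurable_powR _)).
  - exists [set w | D 1 w <= 0]; split.
    + exact: measurable_le_subordinator.
    + exact: subordinator_gt0_null.
    + move=> w /= /not_implyP[_ h]; rewrite leNgt; apply/negP => D0; apply: h.
      by rewrite gE gamma_laplace.
move: H.
rewrite (@fubini_tonelli _ _ _ _ _ P lebesgue_measure
  (fun z => (g z.2 (D 1 z.1))%:E)); last 2 first.
- exact/measurable_EFinP.
- by move=> z; rewrite lee_fin.
rewrite /=.
have -> : (\int[lebesgue_measure]_s \int[P]_w (g s (D 1 w))%:E = (m`!%:R / alpha)%:E)%E.
  rewrite -integral_powR_expR_powR// -/b -gE; apply: eq_integral => s _.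
  rewrite /g; case: ifPn => s0; last by rewrite integral0.
  under eq_integral do rewrite EFinM.
  rewrite ge0_integralZl//; last 2 first.
  - apply/measurable_EFinP; apply: (@measurable_expRN _ _ _ (fun w => s * D 1 w)).
    exact: measurable_funM.
  - by rewrite lee_fin powR_ge0.
  by rewrite subordinator_laplace// mul1r.
under eq_integral do rewrite EFinM muleC.
rewrite ge0_integralZl//; last 3 first.
- apply/measurable_EFinP; exact: (measurableT_comp (measurable_powR _)).
- by move=> w _; rewrite lee_fin powR_ge0.
- by rewrite lee_fin ltW.
move=> E; rewrite EFinM E muleAC -EFinM divff ?mul1e// gt_eqF//.
Qed.

Lemma inverse_moment (t : R) (m : nat) : 0 <= t ->
  (\int[P]_w (Y t w ^+ m)%:E =
   (t `^ (alpha * m%:R) * m`!%:R / Gamma (alpha * m%:R + 1))%:E)%E.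
Proof.
move=> t0; case: m => [|m].
  under eq_integral do rewrite expr0.
  rewrite integral_cst//= mul1e [LHS]probability_setT mulr0 powRr0 add0r.
  by rewrite (Gamma_nat 0) fact0 mulr1 divr1.
have b0 : 0 < alpha * m.+1%:R by rewrite mulr_gt0.
rewrite (@eq_tail_moment _ _ _ _ _ (scaled_law t)); first last.
- by move=> r r0; exact: inverse_tail.
- exact: scaled_law_ge0.
- exact: inverse_ge0.
- exact: scaled_law_measurable.
- exact: inverse_measurable.
under eq_integral => w _.
  rewrite exprMn -!powR_mulrn ?powR_ge0// -!powRrM mulNr EFinM.
  over.
rewrite /= ge0_integralZl//; last 3 first.
- apply/measurable_EFinP; apply: (measurableT_comp (measurable_powR _)).
  exact: (stable_measurable hD).
- by move=> w _; rewrite lee_fin powR_ge0.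
- by rewrite lee_fin powR_ge0.
rewrite negative_moment -EFinM GammaS// factS natrM; congr (_%:E).
field.
by rewrite !gt_eqF// Gamma_gt0.
Qed.

End subordinator.

(** * Double series and Cauchy products *)
Section cauchy_product.
Context {R : realType}.
Local Open Scope ereal_scope.

Lemma nneseries_diagonal (h : nat -> nat -> \bar R) : (forall i j, 0 <= h i j) ->
  \sum_(i <oo) \sum_(j <oo) h i j = \sum_(N <oo) \sum_(i < N.+1) h i (N - i)%N.
Proof.
move=> h0.
pose g i N := if (i <= N)%N then h i (N - i)%N else 0.
have g0 i N : 0 <= g i N by rewrite /g; case: ifP.
transitivity (\sum_(i <oo) \sum_(N <oo) g i N).
  apply: eq_eseriesr => i _.
  rewrite [RHS](nneseries_split 0 i)// add0n big_nat_cond big1 ?add0e; last first.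
    by move=> N /andP[/andP[_ Ni] _]; rewrite /g leqNgt Ni.
  rewrite -(@nneseries_addn _ (g i) i)//.
  by apply: eq_eseriesr => j _; rewrite /g leq_addl addnK.
rewrite nneseries_interchange//.
apply: eq_eseriesr => N _.
rewrite (nneseries_split 0 N.+1)// add0n [X in _ + X]eseries0 ?adde0; last first.
  by move=> i Ni _; rewrite /g leqNgt Ni.
by rewrite big_mkord; apply: eq_bigr => i _; rewrite /g -ltnS ltn_ord.
Qed.

Local Open Scope ring_scope.

Lemma nneseries_fin (c : nat -> R) (l : R) : series c @ \oo --> l ->
  (\sum_(n <oo) (c n)%:E = l%:E)%E.
Proof.
move=> cl; rewrite -(cvg_lim _ cl)// -EFin_lim; last by apply/cvg_ex; exists l.
by congr (limn _); apply/funext => n /=; rewrite /series/= sumEFin.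
Qed.

Lemma fin_nneseries (c : nat -> R) (l : R) : (forall n, 0 <= c n) ->
  (\sum_(n <oo) (c n)%:E = l%:E)%E -> series c @ \oo --> l.
Proof.
move=> c0 E.
have : (\sum_(0 <= k < n) (c k)%:E)%E @[n --> \oo] --> (l%:E : \bar R).
  rewrite -E; apply: is_cvg_nneseries => n _ _; rewrite lee_fin//.
rewrite (_ : (fun n => _) = EFin \o series c); last first.
  by apply/funext => n /=; rewrite /series/= sumEFin.
by move/fine_cvgP => [_].
Qed.

Lemma cauchy_product_ge0 (x y : nat -> R) (X Y : R) :
  (forall n, 0 <= x n) -> (forall n, 0 <= y n) ->
  series x @ \oo --> X -> series y @ \oo --> Y ->
  series (fun N => \sum_(i < N.+1) x i * y (N - i)%N) @ \oo --> X * Y.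
Proof.
move=> x0 y0 xX yY; apply: fin_nneseries.
  by move=> N; apply: sumr_ge0 => i _; rewrite mulr_ge0.
under eq_eseriesr do rewrite -sumEFin.
rewrite -(@nneseries_diagonal (fun i j => (x i * y j)%:E)); last first.
  by move=> i j; rewrite lee_fin mulr_ge0.
have -> : (\sum_(i <oo) \sum_(j <oo) (x i * y j)%:E = \sum_(i <oo) Y%:E * (x i)%:E)%E.
  apply: eq_eseriesr => i _; under eq_eseriesr do rewrite EFinM.
  by rewrite nneseriesZl ?(nneseries_fin yY) ?lee_fin 1?muleC// => n _; rewrite lee_fin.
rewrite nneseriesZl ?(nneseries_fin xX) -?EFinM 1?mulrC//.
by move=> n _; rewrite lee_fin.
Qed.

(** Splitting y into positive and negative parts reduces to the nonnegative
    case. *)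
Lemma cauchy_product (x y : nat -> R) (X Y : R) :
  (forall n, 0 <= x n) -> cvgn (series (fun n => `|y n|)) ->
  series x @ \oo --> X -> series y @ \oo --> Y ->
  series (fun N => \sum_(i < N.+1) x i * y (N - i)%N) @ \oo --> X * Y.
Proof.
move=> x0 yabs xX yY.
pose yp n := (`|y n| + y n) / 2; pose ym n := (`|y n| - y n) / 2.
have nyp n : 0 <= yp n by rewrite divr_ge0// -lerBlDr sub0r -normrN ler_norm.
have nym n : 0 <= ym n by rewrite divr_ge0// subr_ge0 ler_norm.
have cyp : series yp @ \oo --> (limn (series (fun n => `|y n|)) + Y) / 2.
  rewrite (_ : series yp = (fun n => (series (fun n => `|y n|) n + series y n) / 2)).
    by apply: cvgM; [apply: cvgD|exact: cvg_cst].
  by apply/funext => n; rewrite /series/= -big_split/= mulr_suml.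
have cym : series ym @ \oo --> (limn (series (fun n => `|y n|)) - Y) / 2.
  rewrite (_ : series ym = (fun n => (series (fun n => `|y n|) n - series y n) / 2)).
    by apply: cvgM; [apply: cvgB|exact: cvg_cst].
  by apply/funext => n; rewrite /series/= -sumrB mulr_suml.
have -> : X * Y = X * ((limn (series (fun n => `|y n|)) + Y) / 2) -
    X * ((limn (series (fun n => `|y n|)) - Y) / 2) by field.
rewrite (_ : series _ = series (fun N => \sum_(i < N.+1) x i * yp (N - i)%N) -
    series (fun N => \sum_(i < N.+1) x i * ym (N - i)%N)).
  by apply: cvgB; exact: cauchy_product_ge0.
apply/funext => n; rewrite !fctE /series/= -sumrB; apply: eq_bigr => N _.
rewrite -sumrB; apply: eq_bigr => i _.
by rewrite -mulrBr /yp /ym; congr (_ * _); field.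
Qed.

End cauchy_product.

(** * Powers of the jump operators *)
Section operator_binomial.
Context {R : realType} {I : Type}.
Implicit Types (F G H : (I -> R) -> I -> R) (x : I -> R).

Lemma pascal_sum (N : nat) (t : nat -> nat -> R) :
  \sum_(i < N.+2) 'C(N.+1, i)%:R * t i (N.+1 - i)%N =
  \sum_(i < N.+1) 'C(N, i)%:R * t i.+1 (N - i)%N +
  \sum_(i < N.+1) 'C(N, i)%:R * t i (N - i).+1.
Proof.
rewrite big_ord_recl bin0 mul1r subn0.
under eq_bigr => i _ do rewrite /= binS natrD mulrDl subSS.
rewrite big_split/= addrA [RHS]addrC; congr (_ + _).
have -> : \sum_(i < N.+1) 'C(N, i)%:R * t i (N - i).+1 =
    \sum_(i < N.+2) 'C(N, i)%:R * t i (N.+1 - i)%N.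
  rewrite [RHS]big_ord_recr/= bin_small// mul0r addr0.
  by apply: eq_bigr => i _; rewrite subSn// -ltnS.
by rewrite [RHS]big_ord_recl bin0 mul1r subn0.
Qed.

(** Linearity, in the only form that the binomial formula uses. *)
Definition sum_linear F := forall (N : nat) (c : nat -> R) (g : nat -> I -> R),
  F (fun z => \sum_(i < N) c i * g i z) = fun z => \sum_(i < N) c i * F (g i) z.

(** The binomial formula for commuting operators. *)
Lemma iter_binomial F G H x : sum_linear F -> sum_linear G ->
  (forall f z, H f z = F f z + G f z) -> (forall f, G (F f) = F (G f)) ->
  forall N, iter N H x = fun z =>
    \sum_(i < N.+1) 'C(N, i)%:R * iter i F (iter (N - i) G x) z.
Proof.
move=> linF linG HE GF.
have GFi i y : G (iter i F y) = iter i F (G y).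
  by elim: i y => //= i IH y; rewrite GF IH.
elim=> [|N IH]; first by apply/funext => z; rewrite big_ord1 bin0 mul1r.
apply/funext => z; rewrite iterS IH HE.
rewrite (linF _ (fun i => 'C(N, i)%:R) (fun i => iter i F (iter (N - i) G x))).
rewrite (linG _ (fun i => 'C(N, i)%:R) (fun i => iter i F (iter (N - i) G x))).
rewrite (pascal_sum N (fun i j => iter i F (iter j G x) z)).
by congr (_ + _); apply: eq_bigr => i _; rewrite GFi.
Qed.

End operator_binomial.

Section jump_operators.
Context {R : realType}.
Variable k : nat.
Implicit Types (l : R) (s : int) (f : int -> R).

(** For s = -1 this translates a law upwards by 1, ..., k, and for s = 1
    downwards; l is the rate of each jump, and l = 1 / k gives the transition
    operator of one uniform jump. *)
Definition shift_sum l s f : int -> R :=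
  fun z => l * \sum_(1 <= j < k.+1) f (z + s * j%:Z).

Definition delta0 : int -> R := fun z => (z == 0)%:R.

Lemma shift_sum_linear l s : sum_linear (shift_sum l s).
Proof.
move=> N c g; apply/funext => z; rewrite /shift_sum exchange_big/= mulr_sumr.
by apply: eq_bigr => i _; rewrite -mulr_sumr mulrCA.
Qed.

Lemma shift_sumC l l' s s' f :
  shift_sum l s (shift_sum l' s' f) = shift_sum l' s' (shift_sum l s f).
Proof.
apply/funext => z; rewrite /shift_sum -!mulr_sumr !mulrA exchange_big/= [l * l']mulrC.
by congr (_ * _); apply: eq_bigr => i _; apply: eq_bigr => j _; rewrite addrAC.
Qed.

Lemma shift_sumZ c l s f : shift_sum l s (fun z => c * f z) = fun z => c * shift_sum l s f z.
Proof. by apply/funext => z; rewrite /shift_sum -mulr_sumr mulrCA. Qed.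

Lemma iter_shift_sumZ c l s f m :
  iter m (shift_sum l s) (fun z => c * f z) = fun z => c * iter m (shift_sum l s) f z.
Proof. by elim: m => //= m ->; rewrite shift_sumZ. Qed.

Lemma iter_shift_sum_scale c l s f m :
  iter m (shift_sum (c * l) s) f = fun z => c ^+ m * iter m (shift_sum l s) f z.
Proof.
elim: m => [|m IH] /=; first by apply/funext => z; rewrite expr0 mul1r.
rewrite IH shift_sumZ; apply/funext => z.
by rewrite /shift_sum exprS; ring.
Qed.

Lemma iter_shift_sum_ge0 l s f m z : 0 <= l -> (forall z, 0 <= f z) ->
  0 <= iter m (shift_sum l s) f z.
Proof.
move=> l0 f0; elim: m z => //= m IH z; rewrite mulr_ge0//.
by apply: sumr_ge0 => i _; exact: IH.
Qed.

Lemma shift_sum_bound l s f M : 0 <= l -> (forall z, `|f z| <= M) ->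
  forall z, `|shift_sum l s f z| <= k%:R * l * M.
Proof.
move=> l0 fM z; rewrite normrM ger0_norm// [k%:R * l]mulrC -mulrA ler_wpM2l//.
apply: le_trans (ler_norm_sum _ _ _) _.
apply: le_trans (ler_sum _ (fun i _ => fM _)) _.
by rewrite sumr_const_nat subSS subn0 mulr_natl.
Qed.

Variables (lambda1 lambda2 : R).
Hypotheses (lambda1_ge0 : 0 <= lambda1) (lambda2_ge0 : 0 <= lambda2).

Let Lam := k%:R * (lambda1 + lambda2).

Definition jump_sum f : int -> R :=
  fun z => shift_sum lambda1 (-1) f z + shift_sum lambda2 1 f z.

(** The right-hand side of the forward equation; generatorE is its expanded
    form. *)
Definition generator f : int -> R := fun z => jump_sum f z + - Lam * f z.

Lemma Lam_ge0 : 0 <= Lam.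
Proof. by rewrite mulr_ge0 ?addr_ge0. Qed.

Lemma jump_sum_linear : sum_linear jump_sum.
Proof.
move=> N c g; apply/funext => z; rewrite /jump_sum !shift_sum_linear -big_split/=.
by apply: eq_bigr => i _; rewrite mulrDr.
Qed.

Lemma jump_sum_bound f M : (forall z, `|f z| <= M) -> forall z, `|jump_sum f z| <= Lam * M.
Proof.
move=> fM z; apply: le_trans (ler_normD _ _) _.
rewrite /Lam mulrDr mulrDl lerD//; exact: shift_sum_bound.
Qed.

Lemma iter_jump_sum_bound N z : `|iter N jump_sum delta0 z| <= Lam ^+ N.
Proof.
elim: N z => [|N IH] z; first by rewrite /= /delta0 expr0; case: (_ == _); rewrite ?normr1 ?normr0.
by rewrite exprS /=; exact: jump_sum_bound.
Qed.

Lemma iter_generator_bound N z : `|iter N generator delta0 z| <= (2 * Lam) ^+ N.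
Proof.
elim: N z => [|N IH] z; first by rewrite /= /delta0 expr0; case: (_ == _); rewrite ?normr1 ?normr0.
rewrite exprS /= /generator; apply: le_trans (ler_normD _ _) _.
rewrite (_ : 2 * Lam * _ = Lam * (2 * Lam) ^+ N + Lam * (2 * Lam) ^+ N); last by ring.
rewrite lerD//; first exact: jump_sum_bound.
by rewrite normrM normrN (ger0_norm Lam_ge0) ler_wpM2l// Lam_ge0.
Qed.

Lemma iter_jump_sum_ge0 N z : 0 <= iter N jump_sum delta0 z.
Proof.
elim: N z => [|N IH] z; first exact: ler0n.
rewrite /= addr_ge0// mulr_ge0//; apply: sumr_ge0 => i _; exact: IH.
Qed.

Lemma iter_jump_sumE N z : iter N jump_sum delta0 z =
  \sum_(i < N.+1) 'C(N, i)%:R *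
    iter i (shift_sum lambda1 (-1)) (iter (N - i) (shift_sum lambda2 1) delta0) z.
Proof.
rewrite (@iter_binomial _ _ (shift_sum lambda1 (-1)) (shift_sum lambda2 1))//.
- exact: shift_sum_linear.
- exact: shift_sum_linear.
- by move=> f; exact: shift_sumC.
Qed.

Lemma iter_generatorE N z : iter N generator delta0 z =
  \sum_(i < N.+1) 'C(N, i)%:R * (iter i jump_sum delta0 z * (- Lam) ^+ (N - i)).
Proof.
rewrite (@iter_binomial _ _ jump_sum (fun f z => - Lam * f z))//; last 3 first.
- exact: jump_sum_linear.
- by move=> M c g; apply/funext => y; rewrite mulr_sumr; apply: eq_bigr => i _; rewrite mulrCA.
- by move=> f; apply/funext => y; rewrite /jump_sum !shift_sumZ mulrDr.
apply: eq_bigr => i _; congr (_ * _).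
have E j : iter j (fun f z => - Lam * f z) delta0 = fun z => (- Lam) ^+ j * delta0 z.
  elim: j => [|j IH]; first by apply/funext => y; rewrite mul1r.
  by rewrite iterS IH; apply/funext => y; rewrite exprS mulrA.
rewrite E.
have E2 c : iter i jump_sum (fun z => c * delta0 z) = fun z => c * iter i jump_sum delta0 z.
  elim: (nat_of_ord i) => //= j ->; apply/funext => y.
  by rewrite /jump_sum !shift_sumZ mulrDr.
by rewrite E2 mulrC.
Qed.

Lemma generatorE f z : generator f z =
  - (k%:R * (lambda1 + lambda2)) * f z
  + lambda1 * \sum_(1 <= j < k.+1) f (z - j%:Z)
  + lambda2 * \sum_(1 <= j < k.+1) f (z + j%:Z).
Proof.
rewrite /generator /jump_sum /shift_sum addrC addrA; congr (_ + _ * _ + _ * _).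
  by apply: eq_bigr => j _; rewrite mulN1r.
by apply: eq_bigr => j _; rewrite mul1r.
Qed.

End jump_operators.

(** * The exponential series of the generator *)
Section skellam_series.
Context {R : realType}.
Variables (k : nat) (lambda1 lambda2 : R).
Hypotheses (k1 : (1 <= k)%N) (lambda1_ge0 : 0 <= lambda1) (lambda2_ge0 : 0 <= lambda2).

Definition poisson_weight (x : R) m : R := x ^+ m / m`!%:R * expR (- x).

Lemma poisson_weight_ge0 x m : 0 <= x -> 0 <= poisson_weight x m.
Proof. by move=> x0; rewrite mulr_ge0 ?expR_ge0// divr_ge0// exprn_ge0. Qed.

Local Notation U := (shift_sum k (k%:R^-1 : R) (-1)).
Local Notation V := (shift_sum k (k%:R^-1 : R) 1).
Let Lam := k%:R * (lambda1 + lambda2).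

Let fact_gt0 m : 0 < m`!%:R :> R.
Proof. by rewrite ltr0n fact_gt0. Qed.

Lemma binomial_fact_inv N i : (i <= N)%N ->
  (i`!%:R)^-1 * ((N - i)`!%:R)^-1 = 'C(N, i)%:R / N`!%:R :> R.
Proof.
move=> iN; rewrite -(bin_fact iN) !natrM.
by field; rewrite !gt_eqF//= ltr0n bin_gt0.
Qed.

Let rescale (l r : R) s m f z :
  (k%:R * l * r) ^+ m * iter m (shift_sum k (k%:R^-1 : R) s) f z =
  r ^+ m * iter m (shift_sum k l s) f z.
Proof.
have {2}-> : l = (k%:R * l) * k%:R^-1.
  by rewrite mulrAC divff ?mul1r// pnatr_eq0 -lt0n.
by rewrite iter_shift_sum_scale exprMn; ring.
Qed.

(** The case alpha = 1 of the Mittag-Leffler coefficients. *)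
Lemma exp_series_entire (a : nat -> R) (C : R) : 0 <= C -> (forall m, `|a m| <= C ^+ m) ->
  entire (fun m => a m / m`!%:R).
Proof.
move=> C0 aC.
have := @Gamma_entire R 1 C 1 a ltr01 C0.
rewrite (_ : (fun m => a m / Gamma (1 * m%:R + 1)) = (fun m => a m / m`!%:R)); last first.
  by apply/funext => m; rewrite mul1r natr1 Gamma_nat.
by apply => m; rewrite mul1r.
Qed.

(** With the factor exp(-k (lambda1 + lambda2) r) set aside, the terms with
    m1 + m2 = N sum to r^N / N! times the N-th power of jump_sum at delta_0, by
    commutation.  The exponential factor is restored by a Cauchy product, which
    turns powers of jump_sum into powers of the generator. *)
Lemma skellam_series (n : int) (r : R) : 0 <= r ->
  (\sum_(m1 <oo) \sum_(m2 <oo) (poisson_weight (k%:R * lambda1 * r) m1 *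
      poisson_weight (k%:R * lambda2 * r) m2 * iter m1 U (iter m2 V delta0) n)%:E)%E =
  (limn (pseries (fun m => iter m (generator k lambda1 lambda2) delta0 n / m`!%:R) r))%:E.
Proof.
move=> r0.
pose G i j := iter i (shift_sum k lambda1 (-1)) (iter j (shift_sum k lambda2 1) delta0) n.
have G0 i j : 0 <= G i j.
  apply: iter_shift_sum_ge0 => // z; apply: iter_shift_sum_ge0 => // y; exact: ler0n.
pose b N := iter N (jump_sum k lambda1 lambda2) delta0 n.
have b0 N : 0 <= b N by exact: iter_jump_sum_ge0.
have Lam0 : 0 <= Lam by exact: Lam_ge0.
pose F := limn (series (fun N => b N / N`!%:R * r ^+ N)).
have cF : series (fun N => b N / N`!%:R * r ^+ N) @ \oo --> F.
  apply: entire_cvg; apply: (exp_series_entire Lam0) => m; exact: iter_jump_sum_bound.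
have termE m1 m2 : poisson_weight (k%:R * lambda1 * r) m1 *
      poisson_weight (k%:R * lambda2 * r) m2 * iter m1 U (iter m2 V delta0) n =
    expR (- (Lam * r)) * (r ^+ m1 / m1`!%:R * (r ^+ m2 / m2`!%:R) * G m1 m2).
  have -> : expR (- (Lam * r)) = expR (- (k%:R * lambda1 * r)) * expR (- (k%:R * lambda2 * r)).
    by rewrite -expRD; congr expR; rewrite /Lam; ring.
  have H : (k%:R * lambda1 * r) ^+ m1 * ((k%:R * lambda2 * r) ^+ m2 *
      iter m1 U (iter m2 V delta0) n) = r ^+ m1 * (r ^+ m2 * G m1 m2).
    rewrite mulrCA rescale mulrCA; congr (_ * _).
    transitivity (iter m1 (shift_sum k lambda1 (-1))
      (fun z => (k%:R * lambda2 * r) ^+ m2 * iter m2 V delta0 z) n).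
      by rewrite iter_shift_sumZ.
    rewrite (_ : (fun z => _) = fun z => r ^+ m2 * iter m2 (shift_sum k lambda2 1) delta0 z).
      by rewrite iter_shift_sumZ.
    by apply/funext => z; exact: rescale.
  rewrite /poisson_weight; transitivity (expR (- (k%:R * lambda1 * r)) *
    expR (- (k%:R * lambda2 * r)) * (m1`!%:R^-1 * m2`!%:R^-1) *
    ((k%:R * lambda1 * r) ^+ m1 * ((k%:R * lambda2 * r) ^+ m2 *
      iter m1 U (iter m2 V delta0) n))); [by ring|by rewrite H; ring].
have t0 i : 0 <= r ^+ i / i`!%:R by rewrite divr_ge0// exprn_ge0.
have h0 i j : (0 <= (r ^+ i / i`!%:R * (r ^+ j / j`!%:R) * G i j)%:E)%E.
  by rewrite lee_fin mulr_ge0// mulr_ge0.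
transitivity ((expR (- (Lam * r)))%:E * \sum_(i <oo) \sum_(j <oo)
  (r ^+ i / i`!%:R * (r ^+ j / j`!%:R) * G i j)%:E)%E.
  rewrite -nneseriesZl; last by move=> i _; exact: nneseries_ge0.
  apply: eq_eseriesr => i _; rewrite -nneseriesZl//.
  by apply: eq_eseriesr => j _; rewrite termE EFinM.
rewrite nneseries_diagonal//.
have -> : (\sum_(N <oo) \sum_(i < N.+1) (r ^+ i / i`!%:R *
    (r ^+ (N - i) / (N - i)`!%:R) * G i (N - i)%N)%:E)%E = F%:E.
  rewrite -(nneseries_fin cF); apply: eq_eseriesr => N _.
  rewrite sumEFin /b iter_jump_sumE; congr (_%:E).
  rewrite -mulrA mulr_suml; apply: eq_bigr => i _.
  have iN : (i <= N)%N by rewrite -ltnS.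
  transitivity (r ^+ i * r ^+ (N - i) * ((i`!%:R)^-1 * ((N - i)`!%:R)^-1) * G i (N - i)%N).
    by ring.
  by rewrite binomial_fact_inv// -exprD subnKC// /G; ring.
have yabs : cvgn (series (fun j => `|(- (Lam * r)) ^+ j / j`!%:R|)).
  rewrite (_ : (fun j => _) = (fun j => `|1 / j`!%:R * (- (Lam * r)) ^+ j|)).
    apply: entire_cvg_norm; apply: (@exp_series_entire (fun=> 1) 1) => // m.
    by rewrite normr1 expr1n.
  by apply/funext => j; rewrite mul1r mulrC.
have cy : series (fun j => (- (Lam * r)) ^+ j / j`!%:R) @ \oo --> expR (- (Lam * r)).
  exact: is_cvg_series_exp_coeff.
have cx : series (fun i => b i / i`!%:R * r ^+ i) @ \oo --> F by [].
(* the signs are on the exponential side, so only y needs absolute values *)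
have := cauchy_product _ yabs cx cy.
move=> /(_ (fun i => mulr_ge0 (divr_ge0 (b0 i) (ltW (fact_gt0 i))) (exprn_ge0 i r0))) H.
rewrite -EFinM mulrC; congr (_%:E); apply/esym.
apply: (cvg_lim _ _) => //; apply: cvg_trans H; apply: near_eq_cvg; apply: nearW => n0.
rewrite /pseries /series/=; apply: eq_bigr => N _.
rewrite iter_generatorE -/Lam -mulrA mulr_suml; apply: eq_bigr => i _.
have iN : (i <= N)%N by rewrite -ltnS.
have -> : - (Lam * r) = - Lam * r by rewrite mulNr.
rewrite exprMn -/(b i).
move: ((- Lam) ^+ (N - i)) => X.
transitivity (r ^+ i * r ^+ (N - i) * ((i`!%:R)^-1 * ((N - i)`!%:R)^-1) * b i * X); first by ring.
by rewrite binomial_fact_inv// -exprD subnKC//; ring.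
Qed.

End skellam_series.

(** * The laws of compound Poisson and Skellam processes of order k *)
Section partition.
Context d (T : measurableType d) (R : realType) (P : probability T R).

Lemma measure_partition (A : set T) (V : T -> nat) : measurable A ->
  (forall l, measurable (V @^-1` [set l])) ->
  P A = (\sum_(l <oo) P (A `&` V @^-1` [set l]))%E.
Proof.
move=> mA mV.
have AE : A = \bigcup_l (A `&` V @^-1` [set l]).
  by apply/seteqP; split => [w Aw|w [l _ []]]//; exists (V w).
rewrite {1}AE measure_semi_bigcup//.
- by move=> l; exact: measurableI.
- apply/trivIsetP => i j _ _ ij; apply/seteqP; split => w //= [[_ ->] [_ /eqP]].
  by rewrite (negbTE ij).
- by rewrite -AE.
Qed.

Lemma nneseries_finite_support (f : nat -> \bar R) (n : nat) : (forall l, 0 <= f l)%E ->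
  (forall l, (n <= l)%N -> f l = 0%E) -> (\sum_(l <oo) f l = \sum_(0 <= l < n) f l)%E.
Proof.
move=> f0 fn; rewrite (nneseries_split 0 n)// add0n [X in (_ + X)%E]eseries0 ?adde0//.
by move=> l nl _; exact: fn.
Qed.

End partition.

Section jump_sums.
Context d (T : measurableType d) (R : realType) (P : probability T R).
Variables (k : nat) (X : nat -> T -> nat).
Hypothesis hX : iid_uniform P k X.
Local Notation U := (shift_sum k (k%:R^-1 : R) (-1)).
Local Notation V := (shift_sum k (k%:R^-1 : R) 1).

Definition sum_event m (z : int) : set T := [set w | (\sum_(1 <= i < m.+1) X i w)%N%:Z = z].

Let kV0 : 0 <= k%:R^-1 :> R.
Proof. by rewrite invr_ge0. Qed.

Lemma iterU_ge0 m z : 0 <= iter m U delta0 z.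
Proof. by apply: iter_shift_sum_ge0 => // y; exact: ler0n. Qed.

Lemma measurable_jump i (B : set nat) : (1 <= i)%N -> measurable (X i @^-1` B).
Proof.
by move=> i1; rewrite -[X in measurable X]setTI; apply: (iid_measurable hX).
Qed.

Lemma sum_eventS m z : sum_event m.+1 z =
  \bigcup_l (sum_event m (z - l%:Z) `&` X m.+1 @^-1` [set l]).
Proof.
apply/seteqP; split => w /=; rewrite /sum_event/=.
  rewrite big_nat_recr//= PoszD => <-; exists (X m.+1 w) => //; split => //=.
  by rewrite addrK.
by move=> [l _ [/= h Xl]]; rewrite big_nat_recr//= PoszD h Xl subrK.
Qed.

Lemma measurable_sum_event m z : measurable (sum_event m z).
Proof.
elim: m z => [|m IH] z.
  rewrite (_ : sum_event 0 z = [set w | 0%N%:Z = z]); last first.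
    by apply/seteqP; split => w; rewrite /sum_event/= big_geq.
  have [->|z0] := eqVneq z 0; first by rewrite (_ : [set _ | _] = setT)//; apply/seteqP; split.
  rewrite (_ : [set _ | _] = set0)//; apply/seteqP; split => w //= /esym/eqP.
  by rewrite (negbTE z0).
rewrite sum_eventS; apply: bigcup_measurable => l _; apply: measurableI; first exact: IH.
exact: measurable_jump.
Qed.

(** Independence is given as a product formula over finite families of events
    on single jumps.  Carrying the events on the later jumps along makes the induction on m possible without
    knowing beforehand that the partial sum is independent of the next jump. *)
Lemma law_sum_event_indep m z (J : {fset nat}) (B : nat -> set nat) :
  (forall i, i \in J -> (m < i)%N) ->
  P (sum_event m z `&` \bigcap_(i in [set` J]) X i @^-1` B i) =
  ((iter m U delta0 z)%:E * \prod_(i <- J) P (X i @^-1` B i))%E.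
Proof.
have prod_ge0 (K : {fset nat}) (D : nat -> set nat) : (0 <= \prod_(i <- K) P (X i @^-1` D i))%E.
  by apply: prode_ge0 => i _; exact: measure_ge0.
elim: m z J B => [|m IH] z J B mJ.
  have PJ := @iid_independent _ _ _ _ _ _ hX J B mJ (fun=> I).
  have [->|z0] := eqVneq z 0.
    rewrite (_ : sum_event 0 0 = setT) ?setTI ?PJ ?mul1e//.
    by apply/seteqP; split => w; rewrite /sum_event/= ?big_geq.
  rewrite (_ : sum_event 0 z = set0) ?set0I ?measure0 /= /delta0 ?(negbTE z0) ?mul0e//.
  by apply/seteqP; split => w //; rewrite /sum_event/= big_geq// => /esym/eqP; rewrite (negbTE z0).
set C := \bigcap_(i in _) _.
have mC : measurable C.
  apply: fin_bigcap_measurable => [|i /= /mJ mi]; first exact: finite_fset.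
  by apply: measurable_jump; exact: leq_ltn_trans mi.
rewrite (@measure_partition _ _ _ P _ (X m.+1)); last 2 first.
- by apply: measurableI => //; exact: measurable_sum_event.
- by move=> l; exact: measurable_jump.
pose u (l : nat) : R := if (1 <= l <= k)%N then k%:R^-1 else 0.
have u0 l : 0 <= u l by rewrite /u; case: ifP.
have E l : P (sum_event m.+1 z `&` C `&` X m.+1 @^-1` [set l]) =
    ((\prod_(i <- J) P (X i @^-1` B i)) * (u l * iter m U delta0 (z - l%:Z))%:E)%E.
  have mN : m.+1 \notin J by apply/negP => /mJ; rewrite ltnn.
  (* the next jump joins the events carried along *)
  pose B' i := if i == m.+1 then [set l] else B i.
  have -> : sum_event m.+1 z `&` C `&` X m.+1 @^-1` [set l] =
      sum_event m (z - l%:Z) `&` \bigcap_(i in [set` (m.+1 |` J)%fset]) X i @^-1` B' i.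
    apply/seteqP; split => w /=.
      rewrite /sum_event/= => -[[h Cw] Xl]; split.
        by move: h; rewrite big_nat_recr//= PoszD Xl => <-; rewrite addrK.
      move=> i /=; rewrite in_fset1U /B' => /orP[/eqP->|iJ]; first by rewrite eqxx.
      by rewrite ifF; [exact: Cw|apply/negbTE; apply: contraNneq mN => <-].
    rewrite /sum_event/= => -[h Cw].
    have Xl : X m.+1 w = l.
      by have := Cw m.+1; rewrite /= in_fset1U eqxx /B' eqxx; apply.
    split => //; split; first by rewrite big_nat_recr//= PoszD Xl h subrK.
    move=> i /= iJ; have := Cw i; rewrite /= in_fset1U iJ orbT /B' ifF; first exact.
    by apply/negbTE; apply: contraNneq mN => <-.
  rewrite IH; last first.
    by move=> i; rewrite in_fset1U => /orP[/eqP->//|/mJ]; exact: ltnW.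
  rewrite big_fsetU1//= {1}/B' eqxx (iid_law hX)// -/(u l) muleA -EFinM muleC [u l * _]mulrC.
  congr (_ * _)%E; apply: eq_big_seq => i iJ.
  by rewrite /B' ifF//; apply/negbTE; apply: contraNneq mN => <-.
have prodE : (fine (\prod_(i <- J) P (X i @^-1` B i)))%:E = (\prod_(i <- J) P (X i @^-1` B i))%E.
  rewrite fineK// big_seq; apply: prode_fin_num => i /mJ mi; apply: fin_num_measure.
  by apply: measurable_jump; exact: leq_ltn_trans mi.
under eq_eseriesr do rewrite E -prodE.
rewrite nneseriesZl ?prodE; last by move=> l _; rewrite lee_fin mulr_ge0// iterU_ge0.
rewrite muleC; congr (_ * _)%E.
rewrite (@nneseries_finite_support _ _ k.+1); last 2 first.
- by move=> l; rewrite lee_fin mulr_ge0// iterU_ge0.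
- by move=> l kl; rewrite /u (leqNgt l k) kl andbF mul0r.
rewrite sumEFin big_nat_recl// {1}/u/= mul0r add0r; congr (_%:E).
rewrite /shift_sum mulr_sumr big_add1/=; apply: eq_big_nat => l /andP[_ lk].
by rewrite /u /= lk mulN1r.
Qed.

Lemma law_sum_event m z : P (sum_event m z) = (iter m U delta0 z)%:E.
Proof.
have := @law_sum_event_indep m z fset0 (fun=> setT).
rewrite big_seq_fset0 mule1 => <-; last by move=> i; rewrite in_fset0.
by congr (P _); apply/seteqP; split => [w|w []]//; split => // i /=; rewrite in_fset0.
Qed.

Lemma sum_event_sigma m z : sigma_family [set i | (1 <= i)%N] X (sum_event m z).
Proof.
rewrite /sigma_family; set G := \bigcup_(_ in _) _.
rewrite -[<<s G >>]/(@measurable _ (g_sigma_algebraType G)).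
elim: m z => [|m IH] z.
  rewrite (_ : sum_event 0 z = [set w | 0%N%:Z = z]); last first.
    by apply/seteqP; split => w; rewrite /sum_event/= big_geq.
  have [->|z0] := eqVneq z 0; first by rewrite (_ : [set _ | _] = setT)//; apply/seteqP; split.
  rewrite (_ : [set _ | _] = set0)//; apply/seteqP; split => w //= /esym/eqP.
  by rewrite (negbTE z0).
rewrite sum_eventS; apply: bigcup_measurable => l _; apply: measurableI; first exact: IH.
apply: sub_sigma_algebra; exists m.+1 => //=; exists [set l] => //.
by rewrite setTI.
Qed.

End jump_sums.

Section compound_laws.
Context d (T : measurableType d) (R : realType) (P : probability T R).
Variable k : nat.
Hypothesis k1 : (1 <= k)%N.
Local Notation U := (shift_sum k (k%:R^-1 : R) (-1)).
Local Notation V := (shift_sum k (k%:R^-1 : R) 1).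

(** At t = 0 the intensity vanishes and the count is deterministic, so the weight
    is used with the convention 0^0 = 1. *)
Lemma poisson_law (rate : R) (N : R -> T -> nat) (t : R) m : 0 < rate ->
  poisson_process P rate N -> 0 <= t ->
  P (N t @^-1` [set m]) = (poisson_weight (rate * t) m)%:E.
Proof.
move=> rate0 hN; rewrite le_eqVlt => /predU1P[<-|t0].
  rewrite mulr0 /poisson_weight oppr0 expR0 mulr1 expr0n.
  have NE : N 0 @^-1` [set m] = [set w | 0%N = m].
    by apply/seteqP; split => w /=; rewrite (poisson_start hN).
  rewrite NE; have [->|m0] := eqVneq m 0%N.
    rewrite fact0 divr1 (_ : [set _ | _] = setT) ?probability_setT//.
    by apply/seteqP; split.
  rewrite mul0r (_ : [set _ | _] = set0) ?measure0//.
  by apply/seteqP; split => w //= /esym/eqP; rewrite (negbTE m0).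
have := poisson_increment hN m (lexx 0) t0; rewrite subr0 /poisson_pmf mulr_gt0// => E.
rewrite /poisson_weight -E.
by congr (P _); apply/seteqP; split => w /=; rewrite (poisson_start hN) subn0.
Qed.

Lemma PPoK_law (lambda : R) (Nk : R -> T -> nat) (t : R) (z : int) : 0 < lambda ->
  is_PPoK P k lambda Nk -> 0 <= t ->
  measurable [set w | (Nk t w)%:Z = z] /\
  P [set w | (Nk t w)%:Z = z] =
    (\sum_(m <oo) (poisson_weight (k%:R * lambda * t) m * iter m U delta0 z)%:E)%E.
Proof.
move=> lambda0 [N [X [hN hX indep NkE]]] t0.
have mN m : measurable (N t @^-1` [set m]).
  by rewrite -[X in measurable X]setTI; apply: (poisson_measurable hN).
have E m : [set w | (Nk t w)%:Z = z] `&` N t @^-1` [set m] =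
    sum_event X m z `&` N t @^-1` [set m].
  by apply/seteqP; split => w /= [h Nm]; split => //; move: h; rewrite /sum_event/= NkE// Nm.
have mNk : measurable [set w | (Nk t w)%:Z = z].
  rewrite (_ : [set _ | _] = \bigcup_m (sum_event X m z `&` N t @^-1` [set m])).
    apply: bigcup_measurable => m _; apply: measurableI => //.
    exact: (measurable_sum_event hX).
  apply/seteqP; split => w /=.
    by move=> h; exists (N t w) => //; rewrite -E.
  by move=> [m _]; rewrite -E => -[].
split => //.
rewrite (@measure_partition _ _ _ P _ (N t))//.
apply: eq_eseriesr => m _; rewrite E.
rewrite indep; last 2 first.
- exact: sum_event_sigma.
- apply: sub_sigma_algebra; exists t; first by rewrite /times/= in_itv/= t0.
  by exists [set m] => //; rewrite setTI.
rewrite (law_sum_event hX) (poisson_law m _ hN t0) ?mulr_gt0 ?ltr0n//.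
by rewrite -EFinM mulrC.
Qed.

Lemma iterU_neg m (z : int) : z < 0 -> iter m U delta0 z = 0.
Proof.
elim: m z => [|m IH] z z0; first by rewrite /= /delta0 lt_eqF.
rewrite /= /shift_sum big1 ?mulr0// => j _; apply: IH.
by rewrite mulN1r (le_lt_trans _ z0)// gerBl.
Qed.

Lemma iterV_reflect m (z : int) : iter m V delta0 z = iter m U delta0 (- z) :> R.
Proof.
elim: m z => [|m IH] z; first by rewrite /= /delta0 oppr_eq0.
rewrite /= /shift_sum; congr (_ * _); apply: eq_bigr => j _.
by rewrite IH mul1r mulN1r opprD.
Qed.

(** The law of the difference of m1 upward and m2 downward jump sums: applying
    U to the first factor commutes with the sum over the common value j, and
    downward jumps are reflected upward jumps. *)
Lemma convolution_UV m1 m2 (n : int) :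
  (\sum_(j <oo) (iter m1 U delta0 (n + j%:Z) * iter m2 U delta0 j%:Z)%:E =
   (iter m1 U (iter m2 V delta0) n)%:E)%E.
Proof.
have U0 m z : 0 <= iter m U delta0 z by exact: iterU_ge0.
elim: m1 n => [|m1 IH] n.
  rewrite /= iterV_reflect.
  have [n0|n0] := leP n 0; last first.
    rewrite iterU_neg ?oppr_lt0// eseries0// => j _ _.
    by rewrite /delta0 gt_eqF ?mul0r// ltr_wpDr.
  have nE : (- n) = `|n|%N%:Z by rewrite abszE ler0_norm.
  rewrite (nneseries_split 0 `|n|.+1)//=; last first.
    by move=> j _; rewrite lee_fin mulr_ge0// ler0n.
  rewrite add0n [X in (_ + X)%E]eseries0 ?adde0; last first.
    move=> j nj _; rewrite /delta0 gt_eqF ?mul0r//.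
    by rewrite -[n]opprK nE addrC subr_gt0 ltz_nat.
  rewrite big_nat_recr//= big_nat_cond big1 ?add0e; last first.
    move=> j /andP[/andP[_ jn] _]; rewrite /delta0 lt_eqF ?mul0r//.
    by rewrite -[n]opprK nE addrC subr_lt0 ltz_nat.
  by rewrite -nE subrr /delta0 eqxx mul1r.
rewrite [in RHS]iterS /shift_sum.
under eq_eseriesr => j _.
  rewrite iterS /shift_sum -mulrA mulr_suml EFinM -sumEFin.
  over.
rewrite nneseriesZl/=; last first.
  by move=> j _; apply: sume_ge0 => i _; rewrite lee_fin mulr_ge0.
rewrite EFinM -sumEFin; congr (_ * _)%E.
rewrite nneseries_sum_nat; last by move=> i j; rewrite lee_fin mulr_ge0.
apply: eq_bigr => i _; rewrite -IH; apply: eq_eseriesr => j _.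
by rewrite addrAC.
Qed.

(** Conditioning on the value j of the second process gives a triple sum over j
    and the two numbers of jumps; summing over j first leaves skellam_series. *)
Lemma SPoK_law (lambda1 lambda2 : R) (Sk : R -> T -> int) (t : R) (n : int) :
  0 < lambda1 -> 0 < lambda2 -> is_SPoK P k lambda1 lambda2 Sk -> 0 <= t ->
  measurable [set w | Sk t w = n] /\
  P [set w | Sk t w = n] =
    (limn (pseries (fun m => iter m (generator k lambda1 lambda2) delta0 n / m`!%:R) t))%:E.
Proof.
move=> l1 l2 [N1 [N2 [hN1 hN2 indep SE]]] t0.
have L1 z := PPoK_law z l1 hN1 t0.
have L2 z := PPoK_law z l2 hN2 t0.
have U0 m z : 0 <= iter m U delta0 z by exact: iterU_ge0.
have N2E j : N2 t @^-1` [set j] = [set w | (N2 t w)%:Z = j%:Z].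
  by apply/seteqP; split => w /= => [->//|[]].
have E j : [set w | Sk t w = n] `&` N2 t @^-1` [set j] =
    [set w | (N1 t w)%:Z = n + j%:Z] `&` [set w | (N2 t w)%:Z = j%:Z].
  rewrite N2E; apply/seteqP; split => w /=; rewrite SE// => -[h Nj]; split => //.
    by rewrite -h Nj subrK.
  by rewrite h Nj addrK.
have mS : measurable [set w | Sk t w = n].
  rewrite (_ : [set _ | _] = \bigcup_j ([set w | (N1 t w)%:Z = n + j%:Z] `&`
      [set w | (N2 t w)%:Z = j%:Z])).
    by apply: bigcup_measurable => j _; apply: measurableI; [case: (L1 (n + j%:Z))|case: (L2 j)].
  apply/seteqP; split => w /=.
    by move=> h; exists (N2 t w) => //; rewrite -E.
  by move=> [m _]; rewrite -E => -[].
split => //.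
rewrite (@measure_partition _ _ _ P _ (N2 t))//; last first.
  by move=> j; rewrite N2E; case: (L2 j).
pose p1 m := poisson_weight (k%:R * lambda1 * t) m.
pose p2 m := poisson_weight (k%:R * lambda2 * t) m.
have p10 m : 0 <= p1 m by rewrite poisson_weight_ge0// !mulr_ge0// ltW.
have p20 m : 0 <= p2 m by rewrite poisson_weight_ge0// !mulr_ge0// ltW.
transitivity (\sum_(j <oo) \sum_(m1 <oo) \sum_(m2 <oo)
   (p1 m1 * p2 m2 * (iter m1 U delta0 (n + j%:Z) * iter m2 U delta0 j%:Z))%:E)%E.
  apply: eq_eseriesr => j _; rewrite E indep; last 2 first.
  - apply: sub_sigma_algebra; exists t; first by rewrite /times/= in_itv/= t0.
    exists [set j1 : nat | j1%:Z = n + j%:Z] => //.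
    by rewrite setTI.
  - apply: sub_sigma_algebra; exists t; first by rewrite /times/= in_itv/= t0.
    exists [set j1 : nat | j1%:Z = j%:Z] => //.
    by rewrite setTI.
  have [_ ->] := L1 (n + j%:Z); have [_ E2] := L2 j%:Z.
  have fE2 : P [set w | (N2 t w)%:Z = j%:Z] \is a fin_num.
    by apply: fin_num_measure; case: (L2 j).
  rewrite muleC -(fineK fE2) -nneseriesZl; last first.
    by move=> m1 _; rewrite lee_fin mulr_ge0.
  apply: eq_eseriesr => m1 _; rewrite fineK// E2 muleC -nneseriesZl; last first.
    by move=> m2 _; rewrite lee_fin mulr_ge0.
  by apply: eq_eseriesr => m2 _; rewrite -EFinM; congr (_%:E); rewrite /p1 /p2; ring.
rewrite nneseries_interchange; last first.
  by move=> j m1; apply: nneseries_ge0 => m2 _ _; rewrite lee_fin mulr_ge0// mulr_ge0.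
rewrite -(skellam_series k1 (ltW l1) (ltW l2) n t0).
apply: eq_eseriesr => m1 _; rewrite nneseries_interchange; last first.
  by move=> j m2; rewrite lee_fin mulr_ge0// mulr_ge0.
apply: eq_eseriesr => m2 _.
under eq_eseriesr do rewrite EFinM.
rewrite nneseriesZl; last by move=> j _; rewrite lee_fin mulr_ge0.
by rewrite convolution_UV -EFinM.
Qed.

End compound_laws.

(** * Time change by an independent random clock *)
Section right_constant.
Context d (T : measurableType d) (R : realType) (P : probability T R).

(** An integer-valued right-continuous path is constant on a right
    neighbourhood of each time. *)
Lemma poisson_right_constant (rate : R) (N : R -> T -> nat) w (t : R) :
  poisson_process P rate N -> 0 <= t -> \forall x \near t^'+, N x w = N t w.
Proof.
move=> hN t0; have := poisson_right_continuous hN (w := w) t0.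
move=> /cvgrPdist_lt/(_ 1 ltr01); apply: filterS => x.
have [h|h|->//] := ltngtP (N x w) (N t w).
  rewrite -natrB ?(ltnW h)// normr_nat (ltr_nat _ _ 1) ltnS leqn0 subn_eq0.
  by rewrite leqNgt h.
rewrite distrC -natrB ?(ltnW h)// normr_nat (ltr_nat _ _ 1) ltnS leqn0 subn_eq0.
by rewrite leqNgt h.
Qed.

Lemma PPoK_right_constant k (lambda : R) (N : R -> T -> nat) w (t : R) :
  is_PPoK P k lambda N -> 0 <= t -> \forall x \near t^'+, N x w = N t w.
Proof.
move=> [M [X [hM hX _ NE]]] t0; near=> x.
have x0 : 0 <= x by rewrite (le_trans t0).
rewrite !NE//; congr (\sum_(1 <= i < _.+1) _)%N.
near: x; exact: (poisson_right_constant w hM t0).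
Unshelve. all: by end_near. Qed.

Lemma SPoK_right_constant k (lambda1 lambda2 : R) (Sk : R -> T -> int) w (t : R) :
  is_SPoK P k lambda1 lambda2 Sk -> 0 <= t -> \forall x \near t^'+, Sk x w = Sk t w.
Proof.
move=> [N1 [N2 [h1 h2 _ SE]]] t0; near=> x.
have x0 : 0 <= x by rewrite (le_trans t0).
rewrite !SE//; congr (_%:Z - _%:Z).
  near: x; exact: (PPoK_right_constant w h1 t0).
near: x; exact: (PPoK_right_constant w h2 t0).
Unshelve. all: by end_near. Qed.

End right_constant.

Section time_change.
Context d (T : measurableType d) (R : realType) (P : probability T R).
Variables (S : R -> T -> int) (n : int) (q : R -> R).
Variables (Z : R -> T -> R) (t : R).
Local Notation Y := (Z t).
Hypotheses (t0 : 0 <= t) (mY : measurable_fun setT Y) (Y0 : forall w, 0 <= Y w).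
Hypothesis indep : independent_families P (@times R) Z (@times R) S.
Hypothesis mS : forall r : R, 0 <= r -> measurable [set w | S r w = n].
Hypothesis SE : forall r : R, 0 <= r -> P [set w | S r w = n] = (q r)%:E.
Hypothesis Sright : forall w (r : R), 0 <= r -> \forall x \near r^'+, S x w = S r w.
Hypothesis cq : continuous q.

(** The smallest multiple of 1 / (m + 1) strictly above y: strictness lets
    right-constancy of the paths apply at the approximated time. *)
Let grid (m : nat) (y : R) : R := (Num.truncn (m.+1%:R * y)).+1%:R / m.+1%:R.

Let grid_gt m y : y < grid m y.
Proof. by rewrite /grid ltr_pdivlMr// mulrC truncnS_gt. Qed.

Let grid_le m y : 0 <= y -> grid m y <= y + m.+1%:R^-1.
Proof.
move=> y0; rewrite /grid -natr1 mulrDl mul1r lerD2r ler_pdivrMr// mulrC.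
by rewrite truncn_le mulr_ge0.
Qed.

Let grid_cvg y : 0 <= y -> grid m y @[m --> \oo] --> y.
Proof.
move=> y0; apply: (@squeeze_cvgr _ _ _ _ (cst y) (fun m => y + m.+1%:R^-1)).
- by apply: nearW => m; rewrite (ltW (grid_gt _ _)) grid_le.
- exact: cvg_cst.
- rewrite -[X in _ --> X]addr0; apply: cvgD; first exact: cvg_cst.
  exact: cvg_harmonic.
Qed.

Let grid_measurable m : measurable_fun setT (grid m).
Proof.
apply: nondecreasing_measurable => // x y xy.
rewrite /grid ler_pM2r// ler_nat ltnS le_truncn// ler_pM2l//.
Qed.

Let cell m j : set R := `[j%:R / m.+1%:R, j.+1%:R / m.+1%:R[%classic.

Let cellE m j (y : R) : 0 <= y -> cell m j y <-> Num.truncn (m.+1%:R * y) = j.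
Proof.
move=> y0; rewrite /cell/= in_itv/= ler_pdivrMr// ltr_pdivlMr// ![y * _]mulrC.
by split => [/truncn_def//|<-]; rewrite truncn_itv// mulr_ge0.
Qed.

Let A m : set T := [set w | S (grid m (Y w)) w = n].

Let cell_event m j : set T := Y @^-1` cell m j.

Let mcell m j : measurable (cell_event m j).
Proof.
rewrite -[X in measurable X]setTI; apply: mY => //.
exact: measurable_itv.
Qed.

Let AE m : A m = \bigcup_j (cell_event m j `&` [set w | S (j.+1%:R / m.+1%:R) w = n]).
Proof.
apply/seteqP; split => w /=; rewrite /A/=.
  move=> h; exists (Num.truncn (m.+1%:R * Y w)) => //; split => //.
  exact/cellE.
by move=> [j _ [c h]]; rewrite /grid ((cellE m j (Y0 w)).1 c).
Qed.

Let mA m : measurable (A m).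
Proof.
rewrite AE; apply: bigcup_measurable => j _; apply: measurableI => //.
by apply: mS; apply: divr_ge0; exact: ler0n.
Qed.

(** On each cell the approximated clock is a fixed time, so independence of the
    clock and the process applies cell by cell. *)
Let PA m : P (A m) = (\int[P]_w (q (grid m (Y w)))%:E)%E.
Proof.
have trv (F : nat -> set T) : trivIset setT (fun j => cell_event m j `&` F j).
  apply/trivIsetP => i j _ _ ij; apply/seteqP; split => w //= [[ci _] [cj _]].
  by move: ij; rewrite -((cellE m i (Y0 w)).1 ci) ((cellE m j (Y0 w)).1 cj) eqxx.
have s0 j : 0 <= (j.+1%:R / m.+1%:R : R) by rewrite divr_ge0.
have mF j : measurable (cell_event m j `&` [set w | S (j.+1%:R / m.+1%:R) w = n]).
  by apply: measurableI => //; exact: mS.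
rewrite {1}AE measure_semi_bigcup//; last by rewrite -AE.
have TE : setT = \bigcup_j (cell_event m j `&` setT).
  apply/seteqP; split => // w _; exists (Num.truncn (m.+1%:R * Y w)) => //; split => //.
  exact/cellE.
have q0 r : 0 <= r -> 0 <= q r by move=> r0; rewrite -lee_fin -SE.
rewrite TE ge0_integral_bigcup//; last 3 first.
- by move=> j; exact: measurableI.
- rewrite -TE; apply/measurable_EFinP.
  apply: measurableT_comp; first exact: continuous_measurable_fun.
  exact: (measurableT_comp (grid_measurable m)).
- by move=> w _; rewrite lee_fin q0// ltW// (le_lt_trans (Y0 w)).
apply: eq_eseriesr => j _; rewrite setIT.
transitivity (P (cell_event m j) * P [set w | S (j.+1%:R / m.+1%:R) w = n])%E.
  apply: indep; apply: sub_sigma_algebra.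
    exists t; first by rewrite /times/= in_itv/= t0.
    by exists (cell m j); [exact: measurable_itv|rewrite setTI].
  exists (j.+1%:R / m.+1%:R); first by rewrite /times/= in_itv/= s0.
  by exists [set n] => //; rewrite setTI.
rewrite SE// muleC -integral_cst//; apply: eq_integral => w /set_mem c.
by rewrite /grid ((cellE m j (Y0 w)).1 c).
Qed.

Let A_near w : \forall m \near \oo, A m w <-> S (Y w) w = n.
Proof.
have [e /= e0 he] := Sright w (Y0 w).
have : \forall m \near \oo, m.+1%:R^-1 < e by have /cvgr_lt := @cvg_harmonic R; apply.
apply: filterS => m me; rewrite /A/= he//=.
  rewrite distrC ger0_norm ?subr_ge0 ?(ltW (grid_gt _ _))//.
  by rewrite ltrBlDl (le_lt_trans (grid_le _ _))// ltrD2l.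
Qed.

(** Both sides of PA converge, as the approximated times decrease to the clock:
    the left one because the paths are constant to the right of it, the right
    one because q is continuous and bounded at nonnegative times. *)
Lemma time_change : measurable [set w | S (Y w) w = n] /\
  P [set w | S (Y w) w = n] = (\int[P]_w (q (Y w))%:E)%E.
Proof.
have mE : measurable [set w | S (Y w) w = n].
  rewrite (_ : [set _ | _] = \bigcup_M \bigcap_(m in [set m | (M <= m)%N]) A m).
    apply: bigcup_measurable => M _; apply: bigcap_measurable; first by exists M => /=.
    by move=> m _; exact: mA.
  apply/seteqP; split => w /=.
    have [M _ hM] := A_near w.
    by move=> h; exists M => // m /= Mm; apply/(hM m Mm).
  move=> [M _ hM]; have [M' _ hM'] := A_near w.
  by apply/(hM' (maxn M M')); [exact: leq_maxr|apply: hM => /=; exact: leq_maxl].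
split => //.
have q1 r : 0 <= r -> `|q r| <= 1.
  move=> r0; rewrite ger0_norm; first by rewrite -lee_fin -SE//; apply: probability_le1; exact: mS.
  by rewrite -lee_fin -SE.
have c1 : P (A m) @[m --> \oo] --> P [set w | S (Y w) w = n].
  rewrite (_ : (fun m => P (A m)) = (fun m => (\int[P]_w (\1_(A m) w)%:E)%E)); last first.
    by apply/funext => m; rewrite integral_indic// setIT.
  rewrite -[X in _ --> P X]setIT -integral_indic//.
  apply: (@bounded_convergence _ _ _ P _ _ 1).
  - by move=> m; exact: measurable_indic.
  - by move=> m w; rewrite indicE; case: (_ \in _); rewrite ?normr1 ?normr0.
  - move=> w; apply: cvg_near_cst; apply: filterS (A_near w) => m h.
    rewrite !indicE (_ : (w \in A m) = (w \in [set w | S (Y w) w = n]))//.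
    by apply/idP/idP => /set_mem H; apply/mem_set; apply/h.
have c2 : P (A m) @[m --> \oo] --> (\int[P]_w (q (Y w))%:E)%E.
  rewrite (_ : (fun m => P (A m)) = (fun m => (\int[P]_w (q (grid m (Y w)))%:E)%E)); last first.
    by apply/funext => m; rewrite PA.
  apply: (@bounded_convergence _ _ _ P _ _ 1).
  - move=> m; apply: measurableT_comp; first exact: continuous_measurable_fun.
    exact: (measurableT_comp (grid_measurable m)).
  - by move=> m w; apply: q1; rewrite ltW// (le_lt_trans (Y0 w)).
  - move=> w; apply: (@cvg_comp _ _ _ (fun m => grid m (Y w)) q _ (nbhs (Y w))).
      exact: grid_cvg.
    exact: cq.
exact: (cvg_unique (@ereal_hausdorff R) c1 c2).
Qed.

End time_change.

(** * The fractional Skellam process of order k *)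
Section fspok_law.
Context d (T : measurableType d) (R : realType) (P : probability T R).
Variables (k : nat) (lambda1 lambda2 alpha : R) (S : R -> T -> int).
Hypotheses (k1 : (1 <= k)%N) (lambda1_gt0 : 0 < lambda1) (lambda2_gt0 : 0 < lambda2).
Hypothesis alpha01 : 0 < alpha <= 1.
Hypothesis hS : is_FSPoK P k lambda1 lambda2 alpha S.

Local Notation A := (generator k lambda1 lambda2).

Let alpha0 : 0 < alpha. Proof. by have /andP[] := alpha01. Qed.
Let Lam0 : 0 <= k%:R * (lambda1 + lambda2).
Proof. by rewrite mulr_ge0// addr_ge0// ltW. Qed.
Let C := 2 * (k%:R * (lambda1 + lambda2)).
Let C0 : 0 <= C. Proof. by rewrite mulr_ge0. Qed.

Let aC n m : `|iter m A delta0 n| <= C ^+ m.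
Proof. by apply: iter_generator_bound; exact: ltW. Qed.

Let aC1 n m : `|iter m A delta0 n| <= 1 * C ^+ m.
Proof. by rewrite mul1r. Qed.

Definition mittag_leffler_coef (n : int) (m : nat) : R :=
  iter m A delta0 n / Gamma (alpha * m%:R + 1).

Lemma mittag_leffler_coef_entire n : entire (mittag_leffler_coef n).
Proof. exact: (Gamma_entire alpha0 C0 (aC1 n)). Qed.

(** For alpha < 1, the expansion of the law at fixed times in powers of r is
    integrated term by term against the moments of the clock; the absolute
    values sum to the absolute Mittag-Leffler series, which converges. *)
Lemma FSPoK_law (n : int) (t : R) : 0 <= t ->
  state_probability P S n t = limn (pseries (mittag_leffler_coef n) (t `^ alpha)).
Proof.
move=> t0; rewrite /state_probability.
move: hS; rewrite /is_FSPoK; case: ifPn => [/eqP alpha1 hSP|alphaN1].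
  have [_ ->] := SPoK_law k1 n lambda1_gt0 lambda2_gt0 hSP t0.
  rewrite /= alpha1 powRr1//; congr (limn (pseries _ _)).
  apply/funext => m; rewrite /mittag_leffler_coef alpha1 mul1r natr1 Gamma_nat//.
move=> [Sk [D [hSk hD indep SE]]].
pose Y := inverse_subordinator D.
pose q r := limn (pseries (fun m => iter m A delta0 n / m`!%:R) r).
have ent_q : entire (fun m => iter m A delta0 n / m`!%:R).
  exact: exp_series_entire C0 (aC n).
have cq : continuous q.
  move=> r; apply: differentiable_continuous; apply/derivable1_diffP.
  by have [] := entire_derive r ent_q.
have mY : measurable_fun setT (Y t) := inverse_measurable hD t0.
have Y0 w : 0 <= Y t w := inverse_ge0 D t w.
have SkL r r0 := @SPoK_law _ _ _ P k k1 lambda1 lambda2 Sk r n lambda1_gt0 lambda2_gt0 hSk r0.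
have [_ PE] := @time_change _ _ _ P Sk n q Y t t0 mY Y0 indep
  (fun r r0 => proj1 (SkL r r0)) (fun r r0 => proj2 (SkL r r0))
  (fun w r r0 => SPoK_right_constant w hSk r0) cq.
have -> : [set w | S t w = n] = [set w | Sk (Y t w) w = n].
  by apply/seteqP; split => w /=; rewrite SE.
rewrite PE.
pose f m w := iter m A delta0 n / m`!%:R * Y t w ^+ m.
have mfa m : (0 < m`!%:R :> R) by rewrite ltr0n fact_gt0.
have mYm m : measurable_fun setT (fun w => Y t w ^+ m) by exact: measurable_funX.
have iYm m : P.-integrable setT (fun w => (Y t w ^+ m)%:E).
  apply/integrableP; split; first exact/measurable_EFinP.
  under eq_integral do rewrite gee0_abs ?lee_fin ?exprn_ge0//.
  by rewrite (inverse_moment alpha0 hD)// ltry.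
have intf (c : R) m : (\int[P]_w (c / m`!%:R * Y t w ^+ m)%:E)%E =
    (c / Gamma (alpha * m%:R + 1) * (t `^ alpha) ^+ m)%:E.
  under eq_integral do rewrite EFinM.
  rewrite integralZl// (inverse_moment alpha0 hD)// -EFinM; congr (_%:E).
  rewrite -powR_mulrn ?powR_ge0// -powRrM.
  by field; rewrite !gt_eqF// Gamma_gt0// ltr_wpDl// mulr_ge0// ltW.
have absE m : (\int[P]_w (`|f m w|)%:E)%E = (`|mittag_leffler_coef n m * (t `^ alpha) ^+ m|)%:E.
  have g0 : 0 < Gamma (alpha * m%:R + 1) by rewrite Gamma_gt0// ltr_wpDl// mulr_ge0// ltW.
  rewrite normrM (ger0_norm (exprn_ge0 _ (powR_ge0 _ _))).
  rewrite /mittag_leffler_coef normrM normfV (gtr0_norm g0).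
  rewrite -intf//; apply: eq_integral => w _.
  rewrite /f normrM normrM normfV (gtr0_norm (mfa m)).
  by rewrite [in LHS](ger0_norm (exprn_ge0 _ (Y0 w))).
have [] := @integral_series _ _ _ P setT measurableT f (fun w => q (Y t w)).
- by move=> m; apply: measurable_funM.
- under eq_eseriesr do rewrite absE.
  apply: nneseries_fin_lty => //; apply: entire_cvg_norm.
  exact: mittag_leffler_coef_entire.
- by move=> w _; exact: entire_cvg.
move=> ig cv.
have : series (fun m => \int[P]_w f m w) @ \oo -->
    limn (pseries (mittag_leffler_coef n) (t `^ alpha)).
  rewrite (_ : series _ = pseries (mittag_leffler_coef n) (t `^ alpha)).
    apply: entire_cvg; exact: mittag_leffler_coef_entire.
  by apply/funext => N; apply: eq_bigr => m _; rewrite /Rintegral intf.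
by move=> cv2; rewrite -(cvg_unique _ cv cv2).
Qed.

Lemma cvg_sum_nat (K : nat) (u : nat -> nat -> R) (l : nat -> R) :
  (forall j, u j @ \oo --> l j) ->
  (fun N => \sum_(1 <= j < K.+1) u j N) @ \oo --> \sum_(1 <= j < K.+1) l j.
Proof.
move=> ul; elim: K => [|K IH].
  rewrite big_geq//; under eq_fun do rewrite big_geq//.
  exact: cvg_cst.
rewrite big_nat_recr//=; under eq_fun do rewrite big_nat_recr//=.
exact: cvgD.
Qed.

(** The generator only involves finitely many neighbours, so it passes through
    the series. *)
Lemma pseries_generator (n : int) (x : R) :
  limn (pseries (fun m => iter m.+1 A delta0 n / Gamma (alpha * m%:R + 1)) x) =
  - (k%:R * (lambda1 + lambda2)) * limn (pseries (mittag_leffler_coef n) x)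
  + lambda1 * \sum_(1 <= j < k.+1) limn (pseries (mittag_leffler_coef (n - j%:Z)) x)
  + lambda2 * \sum_(1 <= j < k.+1) limn (pseries (mittag_leffler_coef (n + j%:Z)) x).
Proof.
have cv z : pseries (mittag_leffler_coef z) x @ \oo --> limn (pseries (mittag_leffler_coef z) x).
  by apply: entire_cvg; exact: mittag_leffler_coef_entire.
apply: (cvg_lim _) => //.
rewrite (_ : pseries _ x = fun N =>
    - (k%:R * (lambda1 + lambda2)) * pseries (mittag_leffler_coef n) x N
  + lambda1 * \sum_(1 <= j < k.+1) pseries (mittag_leffler_coef (n - j%:Z)) x N
  + lambda2 * \sum_(1 <= j < k.+1) pseries (mittag_leffler_coef (n + j%:Z)) x N).
  apply: cvgD; first apply: cvgD.
  - by apply: cvgM; [exact: cvg_cst|exact: cv].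
  - apply: cvgM; first exact: cvg_cst.
    by apply: (@cvg_sum_nat _ (fun j => pseries (mittag_leffler_coef (n - j%:Z)) x)).
  - apply: cvgM; first exact: cvg_cst.
    by apply: (@cvg_sum_nat _ (fun j => pseries (mittag_leffler_coef (n + j%:Z)) x)).
apply/funext => N; rewrite /pseries /series/=.
rewrite exchange_big/= [X in _ + _ + _ * X]exchange_big/= !mulr_sumr -!big_split/=.
apply: eq_bigr => m _; rewrite generatorE /mittag_leffler_coef.
rewrite -!mulr_suml; ring.
Qed.

Lemma FSPoK_start (n : int) : state_probability P S n 0 = (n == 0)%:R.
Proof.
rewrite FSPoK_law// powR0 ?(gt_eqF alpha0)//.
apply: cvg_lim => //; rewrite -(cvg_shiftS (pseries (mittag_leffler_coef n) 0)).
apply: cvg_near_cst; apply: nearW => N.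
rewrite /pseries /series/= big_nat_recl//= big1 ?addr0; last first.
  by move=> m _; rewrite exprS mul0r mulr0.
by rewrite /mittag_leffler_coef expr0 mulr0 add0r (Gamma_nat 0) fact0 divr1 mulr1.
Qed.

End fspok_law.

Theorem proposition2p1 (R : realType) (d : measure_display)
    (T : measurableType d) (P : probability T R)
    (k : nat) (lambda1 lambda2 alpha : R) (S : R -> T -> int)
    (hk : (1 <= k)%N) (hlambda1 : 0 < lambda1) (hlambda2 : 0 < lambda2)
    (halpha : 0 < alpha <= 1)
    (hS : is_FSPoK P k lambda1 lambda2 alpha S) :
  let p := state_probability P S in
  [/\ forall (n : int) (t : R), 0 < t ->
        ex_caputo alpha (p n) t /\
        caputo alpha (p n) t =
          - (k%:R * (lambda1 + lambda2)) * p n t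
          + lambda1 * \sum_(1 <= j < k.+1) p (n - j%:Z) t
          + lambda2 * \sum_(1 <= j < k.+1) p (n + j%:Z) t,
      p 0 0 = 1 &
      forall n : int, n != 0 -> p n 0 = 0].
Proof.
move=> p.
have pE := FSPoK_law hk hlambda1 hlambda2 halpha hS.
have p0 := FSPoK_start hk hlambda1 hlambda2 halpha hS.
split; last 2 first.
- by rewrite /p p0 eqxx.
- by move=> n n0; rewrite /p p0 (negbTE n0).
move=> n t t0.
have C0 : 0 <= 2 * (k%:R * (lambda1 + lambda2)).
  by rewrite mulr_ge0// mulr_ge0// addr_ge0// ltW.
have aC m : `|iter m (generator k lambda1 lambda2) delta0 n| <=
    1 * (2 * (k%:R * (lambda1 + lambda2))) ^+ m.
  by rewrite mul1r; apply: iter_generator_bound; exact: ltW.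
have [ex ->] := caputo_series halpha C0 aC (fun s s0 => pE n s (ltW s0)) t0.
split => //; rewrite pseries_generator// /p pE ?ltW//.
congr (_ + _ * _ + _ * _).
- by apply: eq_bigr => j _; rewrite pE// ltW.
- by apply: eq_bigr => j _; rewrite pE// ltW.
Qed.
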